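(* Stumpons with decay, unlike cuspons with decay, are not conservative solutions of the Camassa--Holm equation. Precisely, for $u:\mathbb{R}\times\mathbb{R}\to\mathbb{R}$ put $$P(t,x)=\int_{\mathbb{R}}\frac12 e^{-|x-z|}\left(u^2+\frac12u_x^2\right)(t,z)\,dz$$ and consider the conservation law $$(u^2+u_x^2)_t+\left(u(u^2+u_x^2)\right)_x=(u^3-2Pu)_x. \qquad ( * )$$ (i) If $u$ is a stumpon with decay, then $u$ does not satisfy $( * )$ in the weak sense. (ii) If $u$ is a cuspon with decay, then $u$ satisfies $( * )$ in the weak sense.
   Context: The Camassa--Holm equation (with $\kappa=0$) is $u_t-u_{txx}+3uu_x-2u_xu_{xx}-uu_{xxx}=0$, or in nonlocal form $u_t+uu_x+P_x=0$, $P-P_{xx}=u^2+\frac12u_x^2$. Weak sense: $u$ satisfies $( * )$ in the weak sense if for every $\Phi\in C_c^\infty(\mathbb{R}^2)$, $$\iint_{\mathbb{R}^2}\left((u^2+u_x^2)\Phi_t+\left(u(u^2+u_x^2)-u^3+2Pu\right)\Phi_x\right)(t,x)\,dx\,dt=0,$$ where $u_x$ is the weak derivative. Cuspon with decay: let $M,s,m\in\mathbb{R}$ with $2m=s-M$ and either $m<s<M$ or $m>s>M$. A decaying cuspon profile with these parameters is a continuous function $\phi:\mathbb{R}\to\mathbb{R}$ that is $C^\infty$ on $\mathbb{R}\setminus\{0\}$ and satisfies there $$(\phi')^2=\frac{(M-\phi)(\phi-m)^2}{s-\phi},$$ with $\phi(-x)=\phi(x)$, $\phi(0)=s$, $\lim_{x\to\infty}\phi(x)=m$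 (the convergence being exponential), and, for $x>0$, $\phi'(x)<0$ if $s>m$, respectively $\phi'(x)>0$ if $s<m$. A cuspon with decay is $u(t,x)=\phi(x-x_0-st)$ with $x_0\in\mathbb{R}$. Stumpon with decay: assume in addition that the parameters satisfy $$-Mm-(M+m)(s-M-m)=s^2,$$ let $\phi$ be the corresponding decaying cuspon profile, and let $\ell>0$. The stumpon profile is $\psi(x)=s$ for $|x|<\ell$ and $\psi(x)=\phi(|x|-\ell)$ for $|x|\ge\ell$. A stumpon with decay is $u(t,x)=\psi(x-x_0-st)$ with $x_0\in\mathbb{R}$. *)

(* Defs.v *)
From HB Require Import structures.
From mathcomp Require Import all_boot all_order all_algebra.
From mathcomp Require Import all_classical all_reals all_analysis.

Set Implicit Arguments.
Unset Strict Implicit.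
Unset Printing Implicit Defensive.

Import Order.TTheory GRing.Theory Num.Theory numFieldNormedType.Exports.

Local Open Scope classical_set_scope.
Local Open Scope ring_scope.

(* Points of the plane R * R are pairs (t, x): time first, space second. *)

Section plane.
Context {R : realType}.

Definition lebesgue_plane :
    {measure set (measurableTypeR R * measurableTypeR R) -> \bar R} :=
  (lebesgue_measure \x lebesgue_measure)%E.

Definition d_t (f : R * R -> R) : R * R -> R := 'D_((1, 0) : R * R) f.
Definition d_x (f : R * R -> R) : R * R -> R := 'D_((0, 1) : R * R) f.

(* A word [:: b1; ...; bn] denotes the mixed partial derivative
   d_{b1} ... d_{bn} f, where true stands for d_t and false for d_x. *)
Definition iter_partial (w : seq bool) (f : R * R -> R) : R * R -> R :=
  foldr (fun (b : bool) g => if b then d_t g else d_x g) f w.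

Definition smooth_plane (f : R * R -> R) : Prop :=
  forall w : seq bool,
    [/\ continuous (iter_partial w f),
        forall p, derivable (iter_partial w f) p ((1, 0) : R * R)
      & forall p, derivable (iter_partial w f) p ((0, 1) : R * R)].

Definition test_function (Phi : R * R -> R) : Prop :=
  smooth_plane Phi /\ compact (closure [set p | Phi p != 0]).

Definition locally_integrable_plane (f : R * R -> R) : Prop :=
  forall K : set (R * R), compact K ->
    lebesgue_plane.-integrable K (fun p => (f p)%:E).

Definition is_weak_dx (u ux : R * R -> R) : Prop :=
  [/\ measurable_fun [set: measurableTypeR R * measurableTypeR R] u /\ locally_integrable_plane u,
      measurable_fun [set: measurableTypeR R * measurableTypeR R] ux /\ locally_integrable_plane ux
    & forall Phi : R * R -> R, test_function Phi ->
        (\int[lebesgue_plane]_p (u p * d_x Phi p)%:E =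
         - \int[lebesgue_plane]_p (ux p * Phi p)%:E)%E].

Definition nonlocal_P (u ux : R * R -> R) (p : R * R) : R :=
  \int[lebesgue_measure]_z
    (1 / 2 * expR (- `|p.2 - z|) *
     (u (p.1, z) ^+ 2 + 1 / 2 * ux (p.1, z) ^+ 2)).

(* The double integral is taken in \bar R. For a measurable integrand, being
   equal to 0 there entails integrability: the positive and negative parts then
   have equal finite integrals, because +oo - +oo is -oo. *)
Definition satisfies_conservation_law_weakly (u : R * R -> R) : Prop :=
  exists2 ux : R * R -> R, is_weak_dx u ux &
    let P := nonlocal_P u ux in
    forall Phi : R * R -> R, test_function Phi ->
      (\int[lebesgue_plane]_p
        ((u p ^+ 2 + ux p ^+ 2) * d_t Phi p +
         (u p * (u p ^+ 2 + ux p ^+ 2) - u p ^+ 3 + 2 * P p * u p)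
           * d_x Phi p)%:E = 0)%E.

End plane.

Section waves.
Context {R : realType}.

Record decaying_cuspon_profile (M s m : R) (phi : R -> R) : Prop := {
  cuspon_param : 2 * m = s - M;
  cuspon_order : m < s < M \/ M < s < m;
  cuspon_continuous : continuous phi;
  cuspon_smooth : forall (n : nat) (x : R),
    x != 0 -> derivable (derive1n n phi) x 1;
  cuspon_ode : forall x : R, x != 0 ->
    (derive1 phi x) ^+ 2 = (M - phi x) * (phi x - m) ^+ 2 / (s - phi x);
  cuspon_even : forall x : R, phi (- x) = phi x;
  cuspon_crest : phi 0 = s;
  cuspon_limit : phi x @[x --> +oo] --> m;
  cuspon_exponential : exists C c : R,
    0 < c /\ \forall x \near +oo, `|phi x - m| <= C * expR (- (c * x));
  cuspon_decreasing : m < s -> forall x : R, 0 < x -> derive1 phi x < 0;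
  cuspon_increasing : s < m -> forall x : R, 0 < x -> 0 < derive1 phi x
}.

Definition cuspon_with_decay (u : R * R -> R) : Prop :=
  exists (M s m x0 : R) (phi : R -> R),
    decaying_cuspon_profile M s m phi /\
    forall t x : R, u (t, x) = phi (x - x0 - s * t).

Definition stumpon_profile (s l : R) (phi : R -> R) (x : R) : R :=
  if `|x| < l then s else phi (`|x| - l).

Definition stumpon_with_decay (u : R * R -> R) : Prop :=
  exists (M s m l x0 : R) (phi : R -> R),
    [/\ decaying_cuspon_profile M s m phi,
        - (M * m) - (M + m) * (s - M - m) = s ^+ 2,
        0 < l
      & forall t x : R, u (t, x) = stumpon_profile s l phi (x - x0 - s * t)].

End waves.

(* Main.v *)
Require Import Defs.
From HB Require Import structures.
From mathcomp Require Import all_boot all_order all_algebra.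
From mathcomp Require Import all_classical all_reals all_analysis.
From mathcomp Require Import measurable_realfun.
From mathcomp Require Import ring lra.

Set Implicit Arguments.
Unset Strict Implicit.
Unset Printing Implicit Defensive.

Import Order.TTheory GRing.Theory Num.Theory numFieldNormedType.Exports.

(** A cuspon is a stumpon whose plateau has half-length [l = 0], and both are
    handled by one computation in the moving frame. Let [psi] be the profile,
    with plateau [|x| <= l] and corners at [l] and [- l]. Integrating the
    travelling wave equation [- s psi' + psi psi' + P' = 0] suggests the pressure
    [P = s psi - psi^2 / 2 + c], with [c = - m^2 / 2 - M m]. Off the plateau, the
    first integral of the cuspon and its derivative give
    [P - P'' = psi^2 + psi'^2 / 2]; on the plateau this equation reads
    [s^2 = 2 c], which is exactly the relation imposed on the parameters of a
    stumpon. At the corners [psi'] blows up, but [P' = (s - psi) psi'] is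
    continuous, since its square [(s - psi) (M - psi) (psi - m)^2] tends to [0]
    there. Hence [P] is the convolution of [psi^2 + psi'^2 / 2] with the kernel
    [e^(-|x|) / 2] ([integral_wave_source]), which also shows that [psi'^2] is
    locally integrable.

    In the moving frame the flux of the law is
    [(psi - s) (psi^2 + psi'^2) - psi^3 + 2 P psi]. It equals the constant
    [- M m^2] off the plateau ([wave_flux_outside]) and the constant [s^3] on it
    ([wave_flux_plateau]), so testing the law against [Phi] only sees the two
    jumps ([law_functional]) and gives [s^3 + M m^2] times the integral over [t]
    of [Phi (t, l + x0 + s t) - Phi (t, - l + x0 + s t)].
    For [l = 0] this is [0]: cuspons satisfy the law. For a stumpon the relation
    between the parameters forces [s = - 3 m] and [M = - 5 m], so the factor is
    [- 32 m^3], which is not [0] ([stumpon_jump_neq0]), and a product of two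
    bumps whose support meets only one of the two corner lines makes the
    integral positive.

    The law may be tested with any weak derivative of [u]. By the fundamental
    lemma of the calculus of variations ([ae0_of_test_functions]) two weak
    derivatives agree almost everywhere, hence so do the two nonlocal pressures
    ([nonlocal_P_ae_eq]), and the tested law has the same value for both
    ([law_integral_independent]); it is therefore enough to compute it for the
    classical slope. *)
Local Open Scope classical_set_scope.
Local Open Scope ring_scope.

(** * Smooth bump functions *)

Section one_variable.
Context {R : realType}.
Implicit Types (f g : R -> R) (p q : {poly R}).

Lemma cvg_is_derive (V : normedModType R) (f : V -> R) (a v : V) (df : R) :
  (fun h : R => h^-1 *: (f (h *: v + a) - f a)) @ 0^' --> df ->
  is_derive a v f df.
Proof.
move=> fdf; apply: DeriveDef; last exact/cvg_lim.
by apply/cvg_ex; exists df.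
Qed.

Lemma is_derive_congr (V : normedModType R) (f : V -> R) (a v : V) (d d' : R) :
  is_derive a v f d -> d = d' -> is_derive a v f d'.
Proof. by move=> ? <-. Qed.

Lemma near_norm_lt (x l : R) : `|x| < l -> \near x, `|x| < l.
Proof. by move=> xl; exact: (@norm_continuous R R x _ (lt_nbhsl xl)). Qed.

Lemma cvg_sqr (T : Type) (F : set_system T) (h : T -> R) (a : R) : Filter F ->
  h x @[x --> F] --> a -> h x ^+ 2 @[x --> F] --> a ^+ 2.
Proof. by move=> FF ha; exact: (cvg_comp _ _ ha (@exprn_continuous _ 2 _)). Qed.

Lemma cvg_sqr0 (F : set_system R) (h : R -> R) : Filter F ->
  (h x) ^+ 2 @[x --> F] --> (0 : R) -> h x @[x --> F] --> (0 : R).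
Proof.
move=> FF h0; apply/cvgr0Pnorm_lt => e e0.
have H := (cvgr0Pnorm_lt _).1 h0 (e ^+ 2) (exprn_gt0 2 e0).
by apply: (@filterS _ F FF _ _ _ (H FF)) => x; rewrite normrX ltr_sqr// nnegrE ltW.
Qed.

Definition smooth1 f := forall n x, derivable (derive1n n f) x 1.

Lemma is_derive_derive1 f (x df : R) : is_derive x 1 f df -> derive1 f x = df.
Proof. by move=> fdf; rewrite derive1E; exact: derive_val. Qed.

(** Smoothness of an explicit function is proved by finding a class of functions
    that contains it and is stable under differentiation. *)
Lemma smooth1_closed (S : (R -> R) -> Prop) :
  (forall f, S f -> exists2 f', S f' & forall x : R, is_derive x 1 f (f' x)) ->
  forall f, S f -> smooth1 f.
Proof.
move=> HS f Sf n.
suff [g Sg ->] : exists2 g, S g & derive1n n f = g.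
  by move=> x; have [g' _ /(_ x)[]] := HS _ Sg.
elim: n => [|n [g Sg IH]]; first by exists f; rewrite ?derive1n0.
have [g' Sg' gg'] := HS _ Sg; exists g' => //.
by rewrite derive1nS IH; apply/funext => x; exact: is_derive_derive1.
Qed.

Lemma smooth1_continuous f n : smooth1 f -> continuous (derive1n n f).
Proof. by move=> sf x; exact/differentiable_continuous/derivable1_diffP. Qed.

(** With a polynomial factor [p] in [1 / x], this family of extensions of
    [e^(- 1 / x)] by zero is stable under differentiation. *)
Definition flat p (x : R) : R := if 0 < x then p.[x^-1] * expR (- x^-1) else 0.

(** The exponential beats every power: [e^y >= y^(i + 1) / (i + 1)!] at
    [y = 1 / x] leaves one factor [x] to spare. *)
Lemma flat_bound p : exists C : R, forall x, `|flat p x| <= C * `|x|.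
Proof.
exists (\sum_(i < size p) `|p`_i| * (i.+1)`!%:R) => x; rewrite /flat.
case: ifPn => [x0|_]; last first.
  by rewrite normr0 mulr_ge0// sumr_ge0// => i _; rewrite mulr_ge0.
rewrite horner_coef mulr_suml mulr_suml.
apply: (le_trans (ler_norm_sum _ _ _)); apply: ler_sum => i _.
have xi0 : 0 <= x^-1 by rewrite invr_ge0 ltW.
have key : x^-1 ^+ i * expR (- x^-1) <= (i.+1)`!%:R * x.
  have : x^-1 ^+ i.+1 / (i.+1)`!%:R <= expR x^-1.
    by apply: le_trans (expR_ge1Dxn i xi0); rewrite lerDr.
  rewrite ler_pdivrMr ?ltr0n ?fact_gt0// => h.
  rewrite expRN ler_pdivrMr ?expR_gt0// mulrAC -ler_pdivrMr// -exprSr.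
  by rewrite mulrC.
rewrite -mulrA normrM [X in _ <= X](_ : _ = `|p`_i| * ((i.+1)`!%:R * x)); last first.
  by rewrite (gtr0_norm x0) mulrA.
by rewrite ler_wpM2l// ger0_norm// mulr_ge0 ?exprn_ge0 ?expR_ge0.
Qed.

(** At [0] the difference quotient of [flat p] is [flat ('X * p)], which tends
    to [0] by [flat_bound]. *)
Lemma is_derive_flat p x : is_derive x (1:R) (flat p) (flat ('X^2 * (p - p^`())) x).
Proof.
have [x0|x0|->] := ltgtP x 0.
- rewrite {2}/flat ltNge ltW//=.
  apply: (@near_eq_is_derive _ _ _ (cst 0)) => //.
  near=> y; rewrite /flat ifF//; apply/negbTE; rewrite -leNgt ltW//.
  near: y; exact: lt_nbhsl.
- rewrite {2}/flat x0.
  apply: (@near_eq_is_derive R R R ((horner p \o (fun y : R => y^-1)) * (expR \o - (fun y : R => y^-1)))%R).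
    near=> y; rewrite /flat ifT//; near: y; exact: lt_nbhsr.
  have xn0 : x != 0 by rewrite gt_eqF.
  have dV : is_derive x 1 (fun y : R => y^-1) (- x ^- 2).
    by have := @is_deriveV _ id x 1 1 xn0 (is_derive_id _ _); rewrite scaler1.
  have d1 := is_derive1_comp (is_derive_poly p x^-1) dV.
  have d2 := @is_derive1_comp R expR (- (fun y : R => y^-1)) x _ _ (is_derive_expR _) (is_deriveN dV).
  have d12 := is_deriveM d1 d2.
  suff <- : ((horner p \o (fun y : R => y^-1)) x *: (expR (- x^-1) * - - x ^- 2) +
     expR (- x^-1) *: (p^`().[x^-1] * - x ^- 2)) = ('X^2 * (p - p^`())).[x^-1] * expR (- x^-1) by [].
  rewrite /= !hornerE /GRing.scale/= exprVn; ring.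
- have flat0 q : flat q 0 = 0 by rewrite /flat ltxx.
  apply: cvg_is_derive; rewrite !flat0.
  have [C hC] := flat_bound ('X * p).
  have normC0 : (fun h : R => C * `|h|) @ 0^' --> (0 : R).
    rewrite -[X in _ --> X](mulr0 C); apply: cvgMr.
    by apply: cvg_within_filter; have := @norm_continuous R R 0; rewrite /continuous_at normr0.
  apply: (squeeze_cvgr (f := fun h : R => - (C * `|h|)) (h := fun h : R => C * `|h|)).
  + near=> h; rewrite addr0 (_ : h *: (1 : R) = h); last exact: mulr1.
    rewrite -ler_norml; apply: le_trans (hC h).
    rewrite /flat; case: ifPn => h0; last by rewrite subr0 scaler0.
    by rewrite /GRing.scale/= subr0 hornerM hornerX mulrA.
  + by rewrite -[X in _ --> X]oppr0; exact: cvgN normC0.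
  + exact: normC0.
Unshelve. all: by end_near. Qed.

Lemma flatZ (c : R) p x : flat (c *: p) x = c * flat p x.
Proof. by rewrite /flat; case: ifP => _; rewrite ?mulr0// hornerZ mulrA. Qed.

(** The dilation by [n] does not move the support, and makes the bumps
    converge to the indicator of [`]a, b[]. *)
Definition bump (n a b x : R) : R := flat 1 (n * (x - a)) * flat 1 (n * (b - x)).

(** The class of functions used with [smooth1_closed]: products of two flat
    functions alone are not stable under the Leibniz rule, their sums are. *)
Inductive bump_span (n a b : R) : (R -> R) -> Prop :=
| bump_span_atom p q :
    bump_span n a b (fun x => flat p (n * (x - a)) * flat q (n * (b - x)))
| bump_span_add f g : bump_span n a b f -> bump_span n a b g ->
    bump_span n a b (fun x => f x + g x).

Lemma smooth1_bump n a b : smooth1 (bump n a b).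
Proof.
apply: (smooth1_closed (S := bump_span n a b)); last exact: bump_span_atom.
move=> f; elim=> {f} [p q|f g _ [f' Sf' ff'] _ [g' Sg' gg']]; last first.
  exists (fun x => f' x + g' x); first exact: bump_span_add.
  by move=> x; exact: is_deriveD.
pose D (r : {poly R}) := 'X^2 * (r - r^`()).
exists (fun x => flat (n *: D p) (n * (x - a)) * flat q (n * (b - x)) +
                 flat p (n * (x - a)) * flat ((- n) *: D q) (n * (b - x))).
  by apply: bump_span_add; exact: bump_span_atom.
move=> x.
have da : is_derive x 1 (fun y => n * (y - a)) n.
  apply: (@is_derive_eq _ _ _ (n *: ((id : R -> R) - cst a))).
  by rewrite /GRing.scale/= subr0 mulr1.
have db : is_derive x 1 (fun y => n * (b - y)) (- n).
  apply: (@is_derive_eq _ _ _ (n *: (cst b - (id : R -> R)))).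
  by rewrite /GRing.scale/= sub0r mulrN1.
have d1 := @is_derive1_comp R (flat p) (fun y => n * (y - a)) x _ _ (is_derive_flat p (n * (x - a))) da.
have d2 := @is_derive1_comp R (flat q) (fun y => n * (b - y)) x _ _ (is_derive_flat q (n * (b - x))) db.
have d12 := is_deriveM d1 d2.
apply: DeriveDef; first exact: ex_derive.
rewrite (derive_val (is_derive := d12)) !flatZ -/(D p) -/(D q) /GRing.scale/=.
ring.
Qed.

Lemma bump_ge0_le1 n a b x : 0 <= bump n a b x <= 1.
Proof.
have flat01 y : 0 <= flat 1 y <= 1.
  rewrite /flat; case: ifPn => [y0|_]; last by rewrite lexx ler01.
  by rewrite hornerC mul1r expR_ge0 -expR0 ler_expR oppr_le0 invr_ge0 ltW.
have /andP[h0 h1] := flat01 (n * (x - a)).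
have /andP[k0 k1] := flat01 (n * (b - x)).
by rewrite /bump mulr_ge0// mulr_ile1.
Qed.

Lemma bump_gt0 n a b x : 0 < n -> (0 < bump n a b x) = (a < x < b).
Proof.
move=> n0; rewrite /bump /flat.
rewrite (pmulr_rgt0 (x - a) n0) (pmulr_rgt0 (b - x) n0) !subr_gt0.
case: ifP => _; last by rewrite mul0r ltxx.
case: ifP => _; last by rewrite mulr0 ltxx.
by rewrite !hornerC !mul1r mulr_gt0 ?expR_gt0.
Qed.

Lemma bump_eq0 n a b x : 0 < n -> ~~ (a < x < b) -> bump n a b x = 0.
Proof.
move=> n0; rewrite -(bump_gt0 a b x n0) -leNgt => h.
by apply/eqP; rewrite eq_le h; case/andP: (bump_ge0_le1 n a b x).
Qed.

Lemma cvg_bump a b x : bump n.+1%:R a b x @[n --> \oo] --> (\1_`]a, b[%classic x : R).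
Proof.
have flat_cvg y : 0 < y -> flat 1 (n.+1%:R * y) @[n --> \oo] --> (1 : R).
  move=> y0; rewrite [X in X @ _ --> _](_ : _ = (fun n => expR (- (y^-1 * n.+1%:R^-1)))); last first.
    by apply/funext => n; rewrite /flat pmulr_rgt0// y0 hornerC mul1r invfM mulrC.
  have h0 : (- (y^-1 * n.+1%:R^-1) : R) @[n --> \oo] --> - (y^-1 * 0).
    by apply: cvgN; apply: cvgMr; exact: cvg_harmonic.
  have := cvg_comp _ _ h0 (@continuous_expR R _).
  by rewrite mulr0 oppr0 expR0.
have [xab|xab] := boolP (a < x < b).
  rewrite indicE mem_set/=; last by rewrite in_itv.
  move: xab => /andP[ax xb].
  rewrite -[X in _ --> X]mulr1.
  by apply: cvgM; apply: flat_cvg; rewrite subr_gt0.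
rewrite indicE memNset/=; last by rewrite in_itv/=; exact/negP.
apply: cvg_near_cst; apply: nearW => n; exact: bump_eq0.
Qed.

End one_variable.

Section tensor.
Context {R : realType}.
Implicit Types (f g : R -> R) (F : R * R -> R) (p : R * R).

(** A partial derivative is an ordinary derivative along a line. *)
Lemma is_derive_tE F p (df : R) :
  is_derive p ((1, 0) : R * R) F df <-> is_derive p.1 (1 : R) (fun t => F (t, p.2)) df.
Proof.
have E : (fun h : R => h^-1 *: (F (h *: ((1, 0) : R * R) + p) - F p)) =
         (fun h : R => h^-1 *: (F (h *: (1 : R) + p.1, p.2) - F (p.1, p.2))).
  apply/funext => h; congr (_ *: (F _ - F _)); last by case: p.
  by case: p => a b /=; congr (_, _); rewrite /= scaler0 add0r.
by split=> -[h1 h2]; split; rewrite /derivable /derive in h1 h2 *; rewrite ?E// -?E.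
Qed.

Lemma is_derive_xE F p (df : R) :
  is_derive p ((0, 1) : R * R) F df <-> is_derive p.2 (1 : R) (fun x => F (p.1, x)) df.
Proof.
have E : (fun h : R => h^-1 *: (F (h *: ((0, 1) : R * R) + p) - F p)) =
         (fun h : R => h^-1 *: (F (p.1, h *: (1 : R) + p.2) - F (p.1, p.2))).
  apply/funext => h; congr (_ *: (F _ - F _)); last by case: p.
  by case: p => a b /=; congr (_, _); rewrite /= scaler0 add0r.
by split=> -[h1 h2]; split; rewrite /derivable /derive in h1 h2 *; rewrite ?E// -?E.
Qed.

Definition tensor f g (p : R * R) : R := f p.1 * g p.2.

Lemma is_derive_tensor_t f g p (df : R) : is_derive p.1 (1 : R) f df ->
  is_derive p ((1, 0) : R * R) (tensor f g) (df * g p.2).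
Proof.
move=> fdf; apply/is_derive_tE => /=.
rewrite /tensor/= (_ : (fun t => _) = g p.2 *: f); last first.
  by apply/funext => t; rewrite mulrC.
by rewrite mulrC; exact: is_deriveZ.
Qed.

Lemma is_derive_tensor_x f g p (dg : R) : is_derive p.2 (1 : R) g dg ->
  is_derive p ((0, 1) : R * R) (tensor f g) (f p.1 * dg).
Proof.
by move=> gdg; apply/is_derive_xE => /=; exact: (is_deriveZ (f p.1) gdg).
Qed.

Lemma d_t_tensor f g : smooth1 f -> d_t (tensor f g) = tensor (derive1 f) g.
Proof.
move=> sf; apply/funext => p; apply: derive_val.
by apply: is_derive_tensor_t; rewrite derive1E; exact/derivableP/(sf 0).
Qed.

Lemma d_x_tensor f g : smooth1 g -> d_x (tensor f g) = tensor f (derive1 g).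
Proof.
move=> sg; apply/funext => p; apply: derive_val.
by apply: is_derive_tensor_x; rewrite derive1E; exact/derivableP/(sg 0).
Qed.

Lemma smooth1_derive1n f n : smooth1 f -> smooth1 (derive1n n f).
Proof.
move=> sf k; suff -> : derive1n k (derive1n n f) = derive1n (k + n) f by exact: sf.
by rewrite /derive1n iterD.
Qed.

(** Partial derivatives act on separate factors, so only the number of letters
    of each kind in [w] matters. *)
Lemma iter_partial_tensor f g (w : seq bool) : smooth1 f -> smooth1 g ->
  iter_partial w (tensor f g) =
  tensor (derive1n (count id w) f) (derive1n (count negb w) g).
Proof.
move=> sf sg; elim: w => [|b w IH]; first by [].
rewrite /= IH; case: b; rewrite /= ?add0n ?add1n ?derive1nS.
- by rewrite (@d_t_tensor _ _ (@smooth1_derive1n _ _ sf)).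
- by rewrite (@d_x_tensor _ _ (@smooth1_derive1n _ _ sg)).
Qed.

Lemma smooth_plane_tensor f g : smooth1 f -> smooth1 g -> smooth_plane (tensor f g).
Proof.
move=> sf sg w; rewrite iter_partial_tensor//; split.
- move=> p; apply: cvgM.
  + apply: (cvg_comp fst (derive1n (count id w) f)); first exact: cvg_fst.
    exact: smooth1_continuous.
  + apply: (cvg_comp snd (derive1n (count negb w) g)); first exact: cvg_snd.
    exact: smooth1_continuous.
- move=> p; apply: ex_derive; apply: is_derive_tensor_t.
  by apply/derivableP; exact: sf.
- move=> p; apply: ex_derive; apply: is_derive_tensor_x.
  by apply/derivableP; exact: sg.
Qed.

Lemma test_function_tensor f g (a b c d : R) : smooth1 f -> smooth1 g ->
  (forall t, ~~ (a < t < b) -> f t = 0) ->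
  (forall x, ~~ (c < x < d) -> g x = 0) ->
  test_function (tensor f g).
Proof.
move=> sf sg f0 g0; split; first exact: smooth_plane_tensor.
have K : compact (`[a, b]%classic `*` `[c, d]%classic : set (R * R)).
  by apply: compact_setX; exact: segment_compact.
apply: (subclosed_compact _ K); first exact: closed_closure.
have cK : closed (`[a, b]%classic `*` `[c, d]%classic : set (R * R)).
  by apply: compact_closed => //; exact: norm_hausdorff.
rewrite ((closure_id _).1 cK).
apply: closure_subset => -[t x] /=; rewrite /tensor/= mulf_eq0 negb_or.
move=> /andP[ft gx]; rewrite !in_itv/=; split.
- by apply: contraNT ft => h; apply/eqP/f0; apply: contraNN h => /andP[/ltW-> /ltW->].
- by apply: contraNT gx => h; apply/eqP/g0; apply: contraNN h => /andP[/ltW-> /ltW->].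
Qed.

End tensor.

(** * Lebesgue measure on the plane *)

Section plane_measure.
Context {R : realType}.
Notation mu := (@lebesgue_measure R).
Notation plane := (measurableTypeR R * measurableTypeR R)%type.

(** The product sigma-algebra contains the open sets because each of them is a
    union of rectangles with rational corners, of which there are countably
    many. *)
Lemma open_measurable_plane (U : set (R * R)) : open U -> measurable (U : set plane).
Proof.
move=> oU.
pose rect (q : (rat * rat) * (rat * rat)) : set (R * R) :=
  `]ratr q.1.1, ratr q.1.2[%classic `*` `]ratr q.2.1, ratr q.2.2[%classic.
have -> : U = \bigcup_(q in [set q | rect q `<=` U]) rect q.
  rewrite eqEsubset; split => [[t x] Utx|p [q]]; last by apply.
  have [[A B] /= [At Bx] AB] : nbhs (t, x) U by exact: open_nbhs_nbhs.
  have [e /= e0 eA] := At; have [d /= d0 dB] := Bx.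
  have rat_in (y c : R) : 0 < c -> exists q : rat * rat,
      [/\ ratr q.1 < y, y < ratr q.2, y - c < ratr q.1 & ratr q.2 < y + c].
    move=> c0.
    have h1 : y - c < y by rewrite ltrBlDr ltrDl.
    have h2 : y < y + c by rewrite ltrDl.
    have [q1 +] := rat_in_itvoo h1.
    have [q2 +] := rat_in_itvoo h2.
    rewrite !in_itv/= => /andP[? ?] /andP[? ?]; by exists (q1, q2); split.
  have [q1 [q11 q12 q13 q14]] := rat_in t e e0.
  have [q2 [q21 q22 q23 q24]] := rat_in x d d0.
  exists (q1, q2); last by split => /=; rewrite in_itv/=; apply/andP.
  move=> p [/=]; rewrite !in_itv/= => /andP[a1 a2] /andP[b1 b2].
  apply: AB; split; [apply: eA => /=|apply: dB => /=].
    by rewrite ltr_distlC; apply/andP; split; lra.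
  by rewrite ltr_distlC; apply/andP; split; lra.
rewrite bigcup_mkcond; apply: countable_bigcupT_measurable => // q.
by case: ifP => // _; exact: measurableX.
Qed.

Lemma continuous_measurable_plane (F : R * R -> R) :
  continuous F -> measurable_fun [set: plane] F.
Proof.
move=> /continuousP cF; apply: (measurability _ (measurable_realfun.RGenOpens.measurableE R)).
move=> _ [_ [a [b ->] <-]]; rewrite setTI; apply: open_measurable_plane.
exact/cF/interval_open.
Qed.

Lemma compact_measurable_plane (K : set (R * R)) : compact K -> measurable (K : set plane).
Proof.
move=> cK; rewrite -(setCK K); apply: measurableC; apply: open_measurable_plane.
by apply: closed_openC; apply: compact_closed => //; exact: norm_hausdorff.
Qed.

Lemma lebesgue_measure_translation (a : R) (A : set R) :
  measurable (A : set (measurableTypeR R)) -> mu ((+%R a) @^-1` A) = mu A.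
Proof.
have ma : measurable_fun [set: measurableTypeR R] (+%R a : measurableTypeR R -> measurableTypeR R).
  apply: continuous_measurable_fun => x; apply: cvgD; [exact: cvg_cst|exact: cvg_id].
move=> mA; apply/esym.
pose m : {measure set (measurableTypeR R) -> \bar R} :=
  measure_function_pushforward__canonical__measure_function_Measure mu ma.
rewrite -[RHS]/(m A).
apply: lebesgue_measure_unique mA => X [[b c] _ <-] /=.
rewrite /pushforward.
have -> : +%R a @^-1` `]b, c]%classic = `]b - a, c - a]%classic.
  by apply/seteqP; split => y /=; rewrite !in_itv/= => /andP[? ?]; apply/andP; split; lra.
by rewrite !lebesgue_measure_itv/= !lte_fin ltrD2r -!EFinB opprB addrA subrK.
Qed.

(** The change of variables [(t, y) |-> (t, x)] from the frame moving with
    speed [s] and origin [a] to the frame at rest. *)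
Definition shear (a s : R) (p : plane) : plane := (p.1, p.2 + a + s * p.1).

Lemma measurable_shear a s : measurable_fun [set: plane] (shear a s).
Proof.
apply: measurable_fun_pair; first exact: measurable_fst.
apply: measurable_funD; last by apply: measurable_funM => //; exact: measurable_fst.
by apply: measurable_funD => //; exact: measurable_snd.
Qed.

(** At fixed time a shear is a translation, so each section keeps its measure. *)
Lemma lebesgue_plane_shear a s (A : set plane) : measurable A ->
  pushforward lebesgue_plane (shear a s) A = lebesgue_plane A.
Proof.
move=> mA; rewrite /pushforward /lebesgue_plane /= /product_measure1.
apply: eq_integral => t _ /=.
rewrite -(@lebesgue_measure_translation (a + s * t) (xsection A t)); last exact: measurable_xsection.
congr (mu _); apply/seteqP; split => x; rewrite /xsection /shear/= !inE/=;
by have -> : x + a + s * t = a + s * t + x by ring.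
Qed.

Lemma integrable_shear a s (G : plane -> \bar R) :
  measurable_fun [set: plane] G ->
  lebesgue_plane.-integrable setT (G \o shear a s) ->
  lebesgue_plane.-integrable setT G.
Proof.
move=> mG iG; have ms := measurable_shear a s.
have := @integrable_pushforward _ _ _ _ _ _ ms lebesgue_plane setT _ mG.
rewrite preimage_setT => /(_ iG measurableT) /integrableP[_ h].
apply/integrableP; split; first exact: mG.
pose m : {measure set plane -> \bar R} :=
  measure_function_pushforward__canonical__measure_function_Measure lebesgue_plane ms.
rewrite (@eq_measure_integral _ _ _ _ m).
  exact: h.
by move=> A mA _; apply/esym; exact: lebesgue_plane_shear.
Qed.

Lemma integral_shear a s (G : plane -> \bar R) :
  measurable_fun [set: plane] G ->
  lebesgue_plane.-integrable setT (G \o shear a s) ->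
  (\int[lebesgue_plane]_p G p = \int[lebesgue_plane]_p G (shear a s p))%E.
Proof.
move=> mG iG; have ms := measurable_shear a s.
have := @integral_pushforward _ _ _ _ _ _ ms lebesgue_plane setT _ mG.
rewrite preimage_setT => /(_ iG measurableT) <-.
pose m : {measure set plane -> \bar R} :=
  measure_function_pushforward__canonical__measure_function_Measure lebesgue_plane ms.
rewrite (@eq_measure_integral _ _ _ _ m) => [//|A mA _].
by apply/esym; exact: lebesgue_plane_shear.
Qed.

Lemma ge0_integral_translation (a : R) (f : R -> R) :
  measurable_fun [set: measurableTypeR R] f -> (forall x, 0 <= f x) ->
  (\int[mu]_x (f x)%:E = \int[mu]_x (f (a + x))%:E)%E.
Proof.
move=> mf f0.
have ma : measurable_fun [set: measurableTypeR R] (+%R a : measurableTypeR R -> measurableTypeR R).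
  by apply: continuous_measurable_fun => x; apply: cvgD; [exact: cvg_cst|exact: cvg_id].
have := @ge0_integral_pushforward _ _ _ _ R _ ma mu setT (EFin \o f) measurableT.
rewrite preimage_setT => <-; last 2 first.
- exact/measurable_EFinP.
- by move=> y _; rewrite lee_fin.
pose n : {measure set (measurableTypeR R) -> \bar R} :=
  measure_function_pushforward__canonical__measure_function_Measure mu ma.
rewrite (@eq_measure_integral _ _ _ _ n) => [//|A mA _].
by apply/esym; exact: lebesgue_measure_translation.
Qed.

Lemma integralD_eq0 (f g : plane -> R) :
  lebesgue_plane.-integrable setT (EFin \o f) -> lebesgue_plane.-integrable setT (EFin \o g) ->
  (\int[lebesgue_plane]_p (f p + g p)%:E = 0)%E ->
  (\int[lebesgue_plane]_p (f p)%:E = - \int[lebesgue_plane]_p (g p)%:E)%E.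
Proof.
move=> fi gi; under eq_integral do rewrite EFinD.
rewrite integralD//.
have ff := integrable_fin_num measurableT fi; have gf := integrable_fin_num measurableT gi.
rewrite -(fineK ff) -(fineK gf) => -[/eqP]; rewrite addr_eq0 => /eqP ->.
by [].
Qed.

(** Tonelli: the inner integral over [y] is bounded by [C] times the integral
    of [`|h|], and it vanishes for [t] outside a bounded interval. *)
Lemma integrable_strip (h : R -> R) (F : plane -> R) (T C : R) :
  mu.-integrable setT (EFin \o h) ->
  measurable_fun [set: plane] F ->
  (forall t y, `|F (t, y)| <= C * \1_(`[- T, T]%classic) t * `|h y|) ->
  lebesgue_plane.-integrable setT (EFin \o F).
Proof.
move=> ih mF FC; apply/integrable12ltyP; first exact/measurable_EFinP.
have mh : measurable_fun [set: measurableTypeR R] h.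
  by apply/measurable_EFinP; exact: measurable_int ih.
pose H := (\int[mu]_y `|(h y)%:E|)%E.
have H0 : (0 <= H)%E by apply: integral_ge0.
have Hoo : (H < +oo)%E by case/integrableP : ih.
have C0 t : 0 <= \1_(`[- T, T]%classic) t :> R by rewrite indicE.
have mI : measurable_fun [set: measurableTypeR R] (fun t => (\1_(`[- T, T]%classic) t)%:E : \bar R).
  by apply/measurable_EFinP; exact: measurable_indic.
apply: (@le_lt_trans _ _ (\int[mu]_t ((`|C| * \1_(`[- T, T]%classic) t)%:E * H))%E).
  apply: ge0_le_integral => //.
  - by move=> t _; apply: integral_ge0.
  - apply: measurable_fun_fubini_tonelli_F (fun p => `|(F p)%:E|)%E _ _ => //.
    by apply/measurable_EFinP; exact: measurableT_comp.
  - apply: emeasurable_funM => //; apply/measurable_EFinP.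
    by apply: measurable_funM => //; exact/measurable_EFinP.
  - move=> t _; rewrite -ge0_integralZl_EFin ?mulr_ge0//; last first.
      by apply/measurable_EFinP; exact: measurableT_comp.
    apply: ge0_le_integral => //.
    + apply/measurable_EFinP; apply: measurableT_comp => //.
      exact: measurableT_comp (measurable_pair1 t).
    + by apply: emeasurable_funM => //; apply/measurable_EFinP; exact: measurableT_comp.
    + move=> y _; rewrite lee_fin; apply: le_trans (FC t y) _.
      by rewrite ler_wpM2r// ler_wpM2r// ler_norm.
rewrite -[H]fineK ?ge0_fin_numE//.
under eq_integral do rewrite -EFinM mulrAC EFinM.
rewrite ge0_integralZl_EFin//; last by rewrite mulr_ge0// fine_ge0.
rewrite integral_indic// setIT /= lebesgue_measure_itv/=.
by case: ifP => _; rewrite ?mule0 ?ltry.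
Qed.

Definition loc_integrable (h : R -> R) :=
  forall N : R, mu.-integrable `[- N, N] (EFin \o h).

Lemma loc_integrableW (h k : R -> R) : measurable_fun [set: measurableTypeR R] h ->
  (forall y, `|h y| <= `|k y|) -> loc_integrable k -> loc_integrable h.
Proof.
move=> mh hk ik N; apply: le_integrable (ik N) => //.
  by apply/measurable_EFinP; exact: measurable_funS mh.
by move=> y _; rewrite lee_fin.
Qed.

Lemma integrable_box (h : R -> R) (F : plane -> R) (N C : R) :
  loc_integrable h -> measurable_fun [set: plane] F ->
  (forall t y, `|F (t, y)| <= C * `|h y|) ->
  (forall t y, ~~ ((`|t| <= N) && (`|y| <= N)) -> F (t, y) = 0) ->
  lebesgue_plane.-integrable setT (EFin \o F).
Proof.
move=> ih mF FC F0.
have i1 : mu.-integrable setT (EFin \o (h \* \1_(`[- N, N]%classic))).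
  have := (integrable_mkcond _ _).1 (ih N) => /(_ (measurable_itv _)).
  congr (_.-integrable _ _); apply/funext => y /=.
  rewrite patchE indicE /=; case: ifP => _; by rewrite ?mulr1 ?mulr0.
apply: (@integrable_strip _ F N `|C| i1) => // t y.
have [/andP[tN yN]|h0] := boolP ((`|t| <= N) && (`|y| <= N)).
  have tI : t \in (`[- N, N]%classic : set R) by rewrite mem_set//= in_itv/= -ler_norml.
  have yI : y \in (`[- N, N]%classic : set R) by rewrite mem_set//= in_itv/= -ler_norml.
  rewrite /= !indicE tI yI /= !mulr1.
  by apply: le_trans (FC t y) _; rewrite ler_wpM2r// ler_norm.
by rewrite F0// normr0 !mulr_ge0// indicE.
Qed.

(** The sets on which the integral of [f] vanishes form a Dynkin system. *)
Lemma integral0_generated d d' (X : measurableType d) (T : measurableType d')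
    (m : {measure set X -> \bar R}) (phi : X -> T) (B : set X) (f : X -> \bar R)
    (G : set (set T)) :
  measurable_fun setT phi -> measurable B -> m.-integrable B f ->
  measurable = <<s G >> -> setI_closed G ->
  (\int[m]_(x in B) f x = 0)%E ->
  (forall A, G A -> \int[m]_(x in B `&` phi @^-1` A) f x = 0)%E ->
  forall A, measurable A -> (\int[m]_(x in B `&` phi @^-1` A) f x = 0)%E.
Proof.
move=> mphi mB iB mG GI B0 GB.
have mpre (C : set T) : measurable C -> measurable (B `&` phi @^-1` C).
  by move=> mC; apply: measurableI => //; rewrite -[X in measurable X]setTI; exact: mphi.
move=> A mA; have : <<s G >> A by rewrite -mG.
move: A {mA}; apply: (@dynkin_induction _ T G (fun A =>
  \int[m]_(x in B `&` phi @^-1` A) f x = 0)%E mG GI) => //.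
- by rewrite preimage_setT setIT.
- move=> A mA A0.
  have := @integral_setU _ _ _ m (B `&` phi @^-1` A) (B `&` phi @^-1` (~` A)) f.
  rewrite -setIUr -preimage_setU setUv preimage_setT setIT B0 A0 add0e => <- //.
  + exact: mpre.
  + by apply: mpre; exact: measurableC.
  + exact: measurable_int iB.
  + rewrite disj_set2E -setIIr -preimage_setI setICr preimage_set0 setI0; exact/eqP.
- move=> F mF tF F0; rewrite preimage_bigcup setI_bigcupr integral_bigcup.
  + by apply: eseries0 => i _ _; exact: F0.
  + apply/trivIsetP => i j _ _ ij; rewrite -setIIr -preimage_setI.
    by move/trivIsetP: tF => ->//; rewrite preimage_set0 setI0.
  + by move=> k; exact: mpre.
  + apply: integrableS iB => //; first by apply: bigcup_measurable => k _; exact: mpre.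
    by move=> x [k _ []].
Qed.

Let box (a b c d : R) : set plane := `]a, b[%classic `*` `]c, d[%classic.

(** Products of bumps converge boundedly to the indicator of a rectangle, with
    supports in a common compact set, and [f] is integrable there: dominated
    convergence. *)
Lemma integral_box_eq0 (f : plane -> R) :
  measurable_fun [set: plane] f -> locally_integrable_plane f ->
  (forall Phi, test_function Phi -> (\int[lebesgue_plane]_p (f p * Phi p)%:E = 0)%E) ->
  forall a b c d, (\int[lebesgue_plane]_(p in box a b c d) (f p)%:E = 0)%E.
Proof.
move=> mf lf f0 a b c d.
have mbox : measurable (box a b c d) by apply: measurableX; exact: measurable_itv.
pose Phi n := tensor (bump n.+1%:R a b) (bump n.+1%:R c d).
have tPhi n : test_function (Phi n).
  by apply: (test_function_tensor (a := a) (b := b) (c := c) (d := d));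
    [exact: smooth1_bump|exact: smooth1_bump|move=> ?; exact: bump_eq0|move=> ?; exact: bump_eq0].
have mtest P : test_function P -> measurable_fun [set: plane] P.
  by move=> [/(_ [::])[cP _ _] _]; exact: continuous_measurable_plane.
pose K : set (R * R) := `[a, b]%classic `*` `[c, d]%classic.
have cK : compact K by apply: compact_setX; exact: segment_compact.
have mK : measurable (K : set plane) := compact_measurable_plane cK.
have ifK := (integrable_mkcond _ mK).1 (lf _ cK).
have := @dominated_convergence _ _ _ lebesgue_plane setT measurableT
  (fun n p => (f p * Phi n p)%:E) (fun p => (f p * \1_(box a b c d) p)%:E)
  (fun p => `|((fun p => (f p)%:E) \_ K) p|)%E.
case.
- by move=> n; apply/measurable_EFinP; apply: measurable_funM => //; have := mtest _ (tPhi n); exact.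
- by apply/measurable_EFinP; apply: measurable_funM => //; exact: measurable_indic.
- apply: aeW => -[t x] _; apply: cvg_EFin; first exact: nearW.
  apply: cvgMr.
  rewrite [X in _ --> X](_ : _ = \1_`]a, b[%classic t * \1_`]c, d[%classic x); last first.
    by rewrite /box !indicE in_setX; case: (_ \in _); rewrite ?mul0r ?mul1r.
  by apply: cvgM; exact: cvg_bump.
- exact: integrable_abse.
- apply: aeW => -[t x] n _; rewrite patchE; case: ifPn => [_|/negP nK].
    rewrite /= lee_fin.
    have /andP[u0 u1] := bump_ge0_le1 n.+1%:R a b t.
    have /andP[v0 v1] := bump_ge0_le1 n.+1%:R c d x.
    rewrite normrM ler_piMr// /Phi /tensor (ger0_norm (mulr_ge0 u0 v0)).
    exact: mulr_ile1.
  suff P0 : Phi n (t, x) = 0.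
    by rewrite P0 mulr0 abse0.
  apply/eqP; apply: contra_notT nK; rewrite /Phi /tensor/= mulf_eq0 negb_or => /andP[h1 h2].
  rewrite mem_set//; split => /=; rewrite in_itv/=.
    by apply: contraNT h1 => h; rewrite bump_eq0//; apply: contraNN h => /andP[/ltW -> /ltW ->].
  by apply: contraNT h2 => h; rewrite bump_eq0//; apply: contraNN h => /andP[/ltW -> /ltW ->].
move=> _ _.
rewrite (_ : (fun n => _) = cst 0%E); last by apply/funext => n; exact: f0.
move/(cvg_unique _ (@cvg_cst _ _ _ _ _)) => /(_ _) h.
rewrite integral_mkcond; rewrite h; last exact: ereal_hausdorff.
apply: eq_integral => p _; rewrite patchE indicE; case: ifP => _; by rewrite ?mulr1 ?mulr0.
Qed.

End plane_measure.

(** * The fundamental lemma of the calculus of variations *)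

Section fundamental_lemma.
Context {R : realType}.
Notation mu := (@lebesgue_measure R).
Notation plane := (measurableTypeR R * measurableTypeR R)%type.

(** From rectangles to all measurable sets by three applications of
    [integral0_generated]: to the first coordinate ([strip]), to the second
    ([cylinder]), and to the product sigma-algebra. Everything takes place in a
    bounded square, where [f] is integrable. *)
Lemma ae0_of_test_functions (f : plane -> R) :
  measurable_fun [set: plane] f -> locally_integrable_plane f ->
  (forall Phi, test_function Phi -> (\int[lebesgue_plane]_p (f p * Phi p)%:E = 0)%E) ->
  {ae lebesgue_plane, forall p, f p = 0}.
Proof.
move=> mf lf f0.
have fbox := integral_box_eq0 mf lf f0.
pose I (n : nat) : set R := `]- n%:R, n%:R[%classic.
pose B n : set plane := I n `*` I n.
have mB n : measurable (B n) by apply: measurableX; exact: measurable_itv.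
have iB n : lebesgue_plane.-integrable (B n) (EFin \o f).
  pose K : set (R * R) := `[- n%:R, n%:R]%classic `*` `[- n%:R, n%:R]%classic.
  have cK : compact K by apply: compact_setX; exact: segment_compact.
  apply: integrableS (lf _ cK) => //; first exact: compact_measurable_plane.
  by move=> p [/= p1 p2]; split; apply: subset_itv_oo_cc.
have mO : @measurable _ (measurableTypeR R) = <<s @RGenOpens.G R >>.
  exact: RGenOpens.measurableE.
have ooI a b c d : `]a, b[%classic `&` `]c, d[%classic =
    `]Num.max a c, Num.min b d[%classic :> set R.
  apply/seteqP; split => x /=; rewrite !in_itv/= gt_max lt_min.
    by move=> [/andP[-> ->] /andP[-> ->]].
  by move=> /andP[/andP[-> ->] /andP[-> ->]].
have OI : setI_closed (@RGenOpens.G R).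
  move=> _ _ [a [b ->]] [c [d ->]]; rewrite ooI.
  by exists (Num.max a c), (Num.min b d).
have mIO a b : measurable (`]a, b[%classic : set (measurableTypeR R)).
  exact: measurable_itv.
have strip n (A : set (measurableTypeR R)) c d : measurable A ->
    (\int[lebesgue_plane]_(p in (I n `*` (`]c, d[%classic `&` I n)) `&` fst @^-1` A) (f p)%:E = 0)%E.
  move: A; apply: (integral0_generated (G := @RGenOpens.G R)) => //.
  - by rewrite ooI; apply: measurableX; exact: measurable_itv.
  - apply: integrableS (iB n) => //; first by rewrite ooI; apply: measurableX; exact: measurable_itv.
    by move=> p [p1 [_ p2]].
  - rewrite ooI; exact: fbox.
  - move=> _ [a [b ->]]; rewrite ooI -[RHS](fbox (Num.max (- n%:R) a) (Num.min n%:R b)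
      (Num.max c (- n%:R)) (Num.min d n%:R)) -!ooI.
    by congr (integral _ _ _); apply/seteqP; split => p; rewrite /B /I /=; tauto.
have cylinder n (A C : set (measurableTypeR R)) : measurable A -> measurable C ->
    (\int[lebesgue_plane]_(p in (B n `&` fst @^-1` A) `&` snd @^-1` C) (f p)%:E = 0)%E.
  move=> mA; move: C; apply: (integral0_generated (G := @RGenOpens.G R)) => //.
  - by apply: measurableI => //; rewrite -[X in measurable X]setTI; exact: measurable_fst.
  - apply: (integrableS (mB n) _ (@subIsetl _ _ _) (iB n)).
    by apply: measurableI => //; rewrite -[X in measurable X]setTI; exact: measurable_fst.
  - rewrite -[RHS](strip n A (- n%:R) n%:R)//.
    by congr (integral _ _ _); apply/seteqP; split => p; rewrite /B /I /=; tauto.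
  - move=> _ [c [d ->]]; rewrite -[RHS](strip n A c d)//.
    by congr (integral _ _ _); apply/seteqP; split => p; rewrite /B /I /=; tauto.
have all n (E : set plane) : measurable E ->
    (\int[lebesgue_plane]_(p in B n `&` id @^-1` E) (f p)%:E = 0)%E.
  move: E; apply: (integral0_generated (G := [set A `*` C | A in measurable & C in measurable])) => //.
  - exact: measurable_prod_measurableType.
  - move=> _ _ [A mA [C mC <-]] [A' mA' [C' mC' <-]]; rewrite -setXI.
    by exists (A `&` A'); [exact: measurableI|exists (C `&` C') => //; exact: measurableI].
  - exact: fbox.
  - move=> _ [A mA [C mC <-]]; rewrite -[RHS](cylinder n A C)//.
    by congr (integral _ _ _); apply/seteqP; split => p; rewrite /B /I /=; tauto.
have aeB n : {ae lebesgue_plane, forall p, B n p -> f p = 0}.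
  have aeq : ae_eq lebesgue_plane (B n) (EFin \o f) (cst 0%E).
    apply: integral_ae_eq (iB n) _ _ => // E EB mE; rewrite integral0.
    by have := all n E mE; rewrite preimage_id setIidr.
  by apply: filterS aeq => p h /h [].
have := ae_foralln aeB.
apply: filterS => -[t x] h.
pose n := (Num.trunc (`|t| + `|x|)).+1.
have nlt : `|t| + `|x| < n%:R by exact: truncnS_gt.
by apply: (h n); split; rewrite /I /= in_itv/= -ltr_norml; apply: le_lt_trans nlt;
  rewrite ?lerDl ?lerDr.
Qed.

End fundamental_lemma.

(** * The fundamental theorem of calculus with exceptional points *)

Section ftc_exceptional.
Context {R : realType}.
Notation mu := (@lebesgue_measure R).
Implicit Types (F f : R -> R) (S : seq R) (a b x : R).

(** Monotone convergence, applied to the positive and negative parts when [f]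
    has no sign. *)
Lemma cvg_integral_exhaustion (D : (set (measurableTypeR R))^nat) (f : R -> \bar R) :
  nondecreasing_seq D -> (forall n, measurable (D n)) ->
  measurable_fun (\bigcup_n D n) f ->
  (forall x, 0 <= f x)%E \/ mu.-integrable (\bigcup_n D n) f ->
  (\int[mu]_(x in D n) f x)%E @[n --> \oo] --> (\int[mu]_(x in \bigcup_n D n) f x)%E.
Proof.
move=> ndD mD mf.
have mU : measurable (\bigcup_n D n) by apply: bigcup_measurable.
have mfn n : measurable_fun (D n) f.
  by apply: measurable_funS mf => //; exact: bigcup_sup.
case=> [f0|fi]; first exact: ge0_nondecreasing_set_cvg_integral.
rewrite integralE; under eq_fun do rewrite integralE.
apply: cvgeB.
- by apply: fin_num_adde_defl; rewrite fin_numN; exact: integrable_neg_fin_num.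
- apply: ge0_nondecreasing_set_cvg_integral => //.
  by move=> n; exact: measurable_funepos.
- apply: ge0_nondecreasing_set_cvg_integral => //.
  by move=> n; exact: measurable_funeneg.
Qed.

(** Intended for integrands such as the slope of a wave, which blow up at the
    points of [S]; continuity of [F] across [S] is asked for separately. *)
Definition primitive_off S F f a b := forall x, a < x < b -> x \notin S ->
  is_derive x 1 F (f x) /\ {for x, continuous f}.

Lemma FTC_segment F f a b : a < b ->
  (forall x, a <= x <= b -> is_derive x 1 F (f x) /\ {for x, continuous f}) ->
  (\int[mu]_(x in `[a, b]) (f x)%:E = (F b - F a)%:E)%E.
Proof.
move=> ab Ff; rewrite EFinB.
have cF x : a <= x <= b -> {for x, continuous F}.
  by move=> /Ff[dF _]; apply/differentiable_continuous/derivable1_diffP.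
apply: continuous_FTC2 => //.
- apply: continuous_in_subspaceT => x /[!inE]/= /[!in_itv]/= /Ff[]//.
- split.
  + by move=> x; rewrite in_itv/= => /andP[ax xb]; have [|[]] := Ff x; rewrite ?ltW.
  + by apply: cvg_at_right_filter; apply: cF; rewrite lexx ltW.
  + by apply: cvg_at_left_filter; apply: cF; rewrite lexx ltW.
- move=> x; rewrite in_itv/= => /andP[ax xb].
  by apply: is_derive_derive1; have [|] := Ff x; rewrite ?ltW.
Qed.

(** Exhaust the open interval by compact ones and use that [F] is continuous up
    to the end points. *)
Lemma FTC_open F f a b : a < b -> continuous F ->
  (forall x, a < x < b -> is_derive x 1 F (f x) /\ {for x, continuous f}) ->
  measurable_fun `]a, b[ f ->
  (forall x, 0 <= f x) \/ mu.-integrable `]a, b[ (EFin \o f) ->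
  (\int[mu]_(x in `]a, b[) (f x)%:E = (F b - F a)%:E)%E.
Proof.
move=> ab cF Ff mf Hf.
(* the factor 1 / 3 makes [a + d n < b - d n] hold already for [n = 0] *)
pose d n : R := (b - a) / 3 * n.+1%:R^-1.
have d0 n : 0 < d n by rewrite !mulr_gt0 ?subr_gt0 ?invr_gt0.
have dE n : a + d n < b - d n.
  suff : d n <= (b - a) / 3 by move: ab; lra.
  by rewrite ger_pMr ?divr_gt0 ?subr_gt0// invf_le1// ler1n.
have dd n m : (n <= m)%N -> d m <= d n.
  by move=> nm; rewrite ler_pM2l ?divr_gt0 ?subr_gt0// lef_pV2 ?posrE// ler_nat ltnS.
pose D n : set R := `[a + d n, b - d n]%classic.
have intD n : (\int[mu]_(x in D n) (f x)%:E = (F (b - d n) - F (a + d n))%:E)%E.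
  apply: FTC_segment => // x /andP[ax xb]; apply: Ff.
  have d0n := d0 n; by apply/andP; split; lra.
have dlim : d n @[n --> \oo] --> (0 : R).
  by rewrite -[X in _ --> X](mulr0 ((b - a) / 3)); apply: cvgMr; exact: cvg_harmonic.
have limD : (\int[mu]_(x in D n) (f x)%:E)%E @[n --> \oo] --> (F b - F a)%:E%E.
  have lb : b - d n @[n --> \oo] --> b.
    by rewrite -[X in _ --> X]subr0; apply: cvgB => //; exact: cvg_cst.
  have la : a + d n @[n --> \oo] --> a.
    by rewrite -[X in _ --> X]addr0; apply: cvgD => //; exact: cvg_cst.
  under eq_fun do rewrite intD.
  apply: cvg_EFin; first exact: nearW.
  by apply: cvgB; [exact: (cvg_comp _ F lb (cF b))|exact: (cvg_comp _ F la (cF a))].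
have DU : \bigcup_n D n = `]a, b[%classic.
  apply/seteqP; split => [x [n _]|x]; rewrite /D/= !in_itv/= => /andP[ax xb].
    have d0n := d0 n; by apply/andP; split; lra.
  have e0 : 0 < Num.min (x - a) (b - x) by rewrite lt_min !subr_gt0 ax xb.
  have [n _ /(_ n (leqnn n))] := (cvgr0_norm_le d dlim) _ e0.
  rewrite /= gtr0_norm// le_min => /andP[h1 h2].
  by exists n => //=; rewrite in_itv/=; apply/andP; split; lra.
have ndD : nondecreasing_seq D.
  move=> n m nm; rewrite subsetEset => x; rewrite /D/= !in_itv/= => /andP[h1 h2].
  have h := dd _ _ nm; by apply/andP; split; lra.
apply/esym; apply: (cvg_unique _ limD) => //.
rewrite -DU; apply: cvg_integral_exhaustion => //.
- by move=> n; exact: measurable_itv.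
- by rewrite DU; exact/measurable_EFinP.
- by rewrite DU; case: Hf => [f0|]; [left => x; rewrite lee_fin|right].
Qed.

(** Cut the interval at the exceptional points, one at a time; the contributions
    of [F] at the cuts cancel because [F] is continuous. *)
Lemma FTC_off S F f a b : a <= b -> continuous F -> primitive_off S F f a b ->
  measurable_fun [set: measurableTypeR R] f ->
  (forall x, 0 <= f x) \/ mu.-integrable `[a, b] (EFin \o f) ->
  (\int[mu]_(x in `[a, b]) (f x)%:E = (F b - F a)%:E)%E.
Proof.
move=> ab cF + mf; elim: S a b ab => [|c S IH] a b ab Ff Hf.
  move: ab; rewrite le_eqVlt => /predU1P[->|ab].
    by rewrite set_itv1 integral_set1 subrr.
  have moo : measurable_fun (`]a, b[ : set (measurableTypeR R)) (EFin \o f).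
    by apply/measurable_EFinP; exact: measurable_funS mf.
  rewrite integral_itv_bndoo//; apply: FTC_open => //.
  - by move=> x xab; exact: Ff.
  - exact: measurable_funS mf.
  - case: Hf => [f0|fi]; [by left|right].
    by apply: integrableS fi => //; exact: subset_itv_oo_cc.
have [/andP[ac cb]|cab] := boolP (a < c < b); last first.
  apply: IH => // x xab xS; apply: Ff => //; rewrite inE negb_or xS andbT.
  by apply: contraNN cab => /eqP <-.
have sub a' b' : a <= a' -> b' <= b -> `[a', b']%classic `<=` (`[a, b]%classic : set R).
  by move=> aa bb; apply: subset_itv; rewrite bnd_simp.
have Hf' a' b' : a <= a' -> b' <= b ->
    (forall x, 0 <= f x) \/ mu.-integrable `[a', b'] (EFin \o f).
  move=> aa bb; case: Hf => [f0|fi]; [by left|right].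
  by apply: integrableS fi => //; exact: sub.
have split_ab : `[a, b]%classic = `[a, c]%classic `|` `]c, b]%classic :> set R.
  by apply: itv_bndbnd_setU; rewrite bnd_simp ltW.
have mfE (A : set (measurableTypeR R)) : measurable A -> measurable_fun A (EFin \o f).
  by move=> mA; apply/measurable_EFinP; exact: measurable_funS mf.
rewrite split_ab integral_setU//=; last 2 first.
- by rewrite -split_ab; exact: mfE.
- by rewrite disj_set2E; apply/eqP/seteqP; split => x //=; rewrite !in_itv/= => -[/andP[h1 h2] /andP[h3 h4]]; lra.
rewrite integral_itv_obnd_cbnd; last exact: mfE.
rewrite (IH a c (ltW ac)) ?(IH c b (ltW cb)) -?EFinD.
- by congr (_%:E); ring.
- move=> x /andP[h1 h2] xS; apply: Ff; first by apply/andP; split => //; lra.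
  by rewrite inE negb_or xS andbT gt_eqF.
- by apply: Hf' => //; exact: ltW.
- move=> x /andP[h1 h2] xS; apply: Ff; first by apply/andP; split => //; lra.
  by rewrite inE negb_or xS andbT lt_eqF.
- by apply: Hf' => //; exact: ltW.
Qed.

(** For a nonnegative integrand the limits of the primitive at infinity already
    give its integrability. *)
Lemma ge0_FTC_line S F f (A B : R) : continuous F ->
  (forall x, x \notin S -> is_derive x 1 F (f x) /\ {for x, continuous f}) ->
  measurable_fun [set: measurableTypeR R] f -> (forall x, 0 <= f x) ->
  F x @[x --> -oo] --> A -> F x @[x --> +oo] --> B ->
  (\int[mu]_x (f x)%:E = (B - A)%:E)%E.
Proof.
move=> cF Ff mf f0 FA FB.
pose D n : set (measurableTypeR R) := `[- n%:R, n%:R]%classic.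
have DU : \bigcup_n D n = setT.
  apply/seteqP; split => // x _; exists (Num.trunc `|x|).+1 => //.
  by rewrite /D/= in_itv/= -ler_norml ltW// truncnS_gt.
have <- : (\int[mu]_(x in \bigcup_n D n) (f x)%:E = \int[mu]_x (f x)%:E)%E by rewrite DU.
have ndD : nondecreasing_seq D.
  move=> n m nm; rewrite subsetEset => x; rewrite /D/= !in_itv/= -!ler_norml => /le_trans; apply.
  by rewrite ler_nat.
have lim1 : (\int[mu]_(x in D n) (f x)%:E)%E @[n --> \oo] -->
    (\int[mu]_(x in \bigcup_n D n) (f x)%:E)%E.
  apply: cvg_integral_exhaustion => //.
  - by move=> n; exact: measurable_itv.
  - by rewrite DU; exact/measurable_EFinP.
  - by left => x; rewrite lee_fin.
apply: (cvg_unique _ lim1) => //.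
rewrite (_ : (fun n => _) = (fun n : nat => (F n%:R - F (- n%:R))%:E)); last first.
  apply/funext => n; apply: (FTC_off (S := S)) => //; last by left.
    by rewrite lerNl (le_trans _ (ler0n _ n))// oppr_le0.
  by move=> x _; exact: Ff.
apply: cvg_EFin; first exact: nearW.
have ny : (n%:R : R) @[n --> \oo] --> +oo by exact: cvgr_idn.
apply: cvgB; first exact: (cvg_pinftyP _ _).1 FB _ ny.
have nNy : (- n%:R : R) @[n --> \oo] --> -oo by exact/cvgNrNy.
exact: (cvg_ninftyP F A).1 FA _ nNy.
Qed.

End ftc_exceptional.

Section compact_support.
Context {R : realType}.
Notation mu := (@lebesgue_measure R).

Lemma FTC_compact (S : seq R) (F f : R -> R) (N : R) : 0 <= N -> continuous F ->
  (forall x, x \notin S -> is_derive x 1 F (f x) /\ {for x, continuous f}) ->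
  measurable_fun [set: measurableTypeR R] f ->
  mu.-integrable `[- N, N] (EFin \o f) ->
  (forall x, N < `|x| -> f x = 0) ->
  (\int[mu]_x (f x)%:E = (F N - F (- N))%:E)%E.
Proof.
move=> N0 cF Ff mf fi f0.
rewrite -(@FTC_off R S F f (- N) N) //; last 3 first.
- by rewrite lerNl (le_trans _ N0)// oppr_le0.
- by move=> x _; exact: Ff.
- by right.
rewrite [RHS]integral_mkcond; apply: eq_integral => x _.
rewrite patchE; case: ifPn => // /negP xN; rewrite f0// ltNge; apply/negP => h.
by apply: xN; rewrite inE/= in_itv/= -ler_norml.
Qed.

Lemma measurable_continuous_off (S : seq R) (f : R -> R) :
  (forall x, x \notin S -> {for x, continuous f}) ->
  measurable_fun [set: measurableTypeR R] f.
Proof.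
move=> cf _ Y mY; rewrite setTI.
pose D : set (measurableTypeR R) := ~` [set` S].
have oD : open (D : set R).
  apply: closed_openC; apply: compact_closed; first exact: norm_hausdorff.
  by apply: finite_compact; exact: finite_seq.
have -> : f @^-1` Y = (D `&` f @^-1` Y) `|` ([set` S] `&` f @^-1` Y).
  by rewrite -setIUl setUC setUv setTI.
apply: measurableU.
  apply: (@open_continuous_measurable_fun R D f oD _ _ Y mY); last exact: open_measurable.
  by move=> x; rewrite inE /D/= => /negP xS; exact: cf.
apply: countable_measurable => //; apply: finite_set_countable.
by apply: sub_finite_set (finite_seq S); exact: subIsetl.
Qed.

Lemma loc_integrableM (h b : R -> R) (C : R) :
  measurable_fun [set: measurableTypeR R] h -> measurable_fun [set: measurableTypeR R] b ->
  loc_integrable h -> (forall y, `|b y| <= C) -> loc_integrable (fun y => h y * b y).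
Proof.
move=> mh mb ih bC N.
have := @integrableZl _ _ _ mu _ (measurable_itv `[- N, N]) C _ (ih N).
apply: le_integrable => //.
  by apply/measurable_EFinP; apply: measurable_funS (measurable_funM mh mb).
move=> y _; rewrite /= lee_fin !normrM mulrC ler_wpM2r//.
by apply: le_trans (bC y) _; rewrite ler_norm.
Qed.

Lemma loc_integrableD (h k : R -> R) :
  loc_integrable h -> loc_integrable k -> loc_integrable (fun y => h y + k y).
Proof. by move=> ih ik N; apply: (integrableD _ (ih N) (ik N)); exact: measurable_itv. Qed.

Lemma loc_integrable_bounded (h : R -> R) (C : R) :
  measurable_fun [set: measurableTypeR R] h -> (forall y, `|h y| <= C) -> loc_integrable h.
Proof.
move=> mh hC N; apply: measurable_bounded_integrable => //.
- by rewrite /= lebesgue_measure_itv/=; case: ifP => _; rewrite ?ltry.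
- exact: measurable_funS mh.
- by exists C; split; rewrite ?num_real// => x Cx y _; exact: le_trans (hC y) (ltW Cx).
Qed.

End compact_support.

Section compactly_supported_functions.
Context {R : realType}.

Lemma bounded_compact_support (T : topologicalType) (f : T -> R) (K : set T) :
  compact K -> continuous f -> (forall x, ~ K x -> f x = 0) ->
  exists2 C : R, 0 <= C & forall x, `|f x| <= C.
Proof.
move=> cK cf f0.
have [C [_ hC]] : bounded_set (f @` K).
  by apply: compact_bounded; apply: continuous_compact => //; exact: continuous_subspaceT.
exists (`|C| + 1) => [|x]; first by rewrite addr_ge0.
have [Kx|Kx] := pselect (K x); last by rewrite f0// normr0 addr_ge0.
by apply: (hC (`|C| + 1)); [rewrite (le_lt_trans (ler_norm C))// ltrDl|exists x].
Qed.

Definition C1_compact (N : R) (b b' : R -> R) :=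
  [/\ forall y : R, is_derive y 1 b (b' y), continuous b' &
      forall y, N <= `|y| -> b y = 0 /\ b' y = 0].

Lemma C1_compact_continuous N b b' : C1_compact N b b' -> continuous b.
Proof.
by move=> [bb' _ _] y; apply/differentiable_continuous/derivable1_diffP; have [] := bb' y.
Qed.

Lemma C1_compact_bounded N b b' : C1_compact N b b' ->
  exists2 C, 0 <= C & forall y, `|b y| <= C /\ `|b' y| <= C.
Proof.
move=> bN; have cb := C1_compact_continuous bN; have [_ cb' b0] := bN.
have cK := @segment_compact R (- N) N.
have out y : ~ `[- N, N]%classic y -> N <= `|y|.
  move=> h; rewrite leNgt; apply/negP => yN; apply: h.
  by rewrite /= in_itv/= -ler_norml ltW.
have [C C0 hC] := bounded_compact_support cK cb (fun y h => (b0 y (out y h)).1).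
have [C' C'0 hC'] := bounded_compact_support cK cb' (fun y h => (b0 y (out y h)).2).
exists (C + C') => [|y]; first by rewrite addr_ge0.
by split; [apply: le_trans (hC y) _; rewrite lerDl|apply: le_trans (hC' y) _; rewrite lerDr].
Qed.

End compactly_supported_functions.

(** * Profiles of travelling waves *)

Section profile.
Context {R : realType}.
Variables (M s m : R) (phi : R -> R).
Hypothesis Hphi : decaying_cuspon_profile M s m phi.
Notation mu := (@lebesgue_measure R).

Let phi' : R -> R := derive1 phi.

Lemma cuspon_is_derive (x : R) : x != 0 -> is_derive x 1 phi (phi' x).
Proof.
move=> x0; rewrite /phi' derive1E; apply/derivableP.
exact: (@cuspon_smooth _ _ _ _ _ Hphi 0%N x x0).
Qed.

Lemma cuspon_is_derive2 (x : R) : x != 0 -> is_derive x 1 phi' (derive1 phi' x).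
Proof.
move=> x0; rewrite derive1E; apply/derivableP.
exact: (@cuspon_smooth _ _ _ _ _ Hphi 1%N x x0).
Qed.

Lemma cuspon_mvt (a b : R) : 0 <= a -> a < b ->
  exists2 x, a < x & phi b - phi a = phi' x * (b - a).
Proof.
move=> a0 ab.
have [|x|x /[!in_itv]/= /andP[ax _] E] := @MVT _ phi phi' a b ab.
- move=> x /[!in_itv]/= /andP[ax _]; apply: cuspon_is_derive.
  by rewrite gt_eqF// (le_lt_trans a0).
- apply: continuous_subspaceT; exact: cuspon_continuous Hphi.
- by exists x.
Qed.

(** On the half-line the profile is strictly monotone from the crest value [s]
    to the limit [m]. *)
Lemma cuspon_range (x : R) : 0 < x ->
  m < s /\ m <= phi x < s \/ s < m /\ s < phi x <= m.
Proof.
move=> x0; have [/andP[ms _]|/andP[_ sm]] := cuspon_order Hphi; [left|right]; split => //.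
- apply/andP; split.
    apply: (cvgr_to_le (cuspon_limit Hphi)).
    near=> y; have xy : x < y by near: y; apply: nbhs_pinfty_gt; rewrite num_real.
    have [z xz /eqP] := cuspon_mvt (ltW x0) xy.
    rewrite -subr_le0 => /eqP ->; rewrite nmulr_rle0 ?subr_ge0 ?ltW//.
    by apply: (cuspon_decreasing Hphi ms); exact: lt_trans xz.
  have [z z0 /eqP] := cuspon_mvt (lexx 0) x0.
  rewrite (cuspon_crest Hphi) subr0 -subr_lt0 => /eqP ->.
  by rewrite pmulr_llt0// (cuspon_decreasing Hphi ms).
- apply/andP; split.
    have [z z0 /eqP] := cuspon_mvt (lexx 0) x0.
    rewrite (cuspon_crest Hphi) subr0 -subr_gt0 => /eqP ->.
    by rewrite mulr_gt0// (cuspon_increasing Hphi sm).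
  apply: (cvgr_to_ge (cuspon_limit Hphi)).
  near=> y; have xy : x < y by near: y; apply: nbhs_pinfty_gt; rewrite num_real.
  have [z xz /eqP] := cuspon_mvt (ltW x0) xy.
  rewrite -subr_ge0 => /eqP ->; rewrite mulr_ge0 ?subr_ge0 ?ltW//.
  by apply: (cuspon_increasing Hphi sm); exact: lt_trans xz.
Unshelve. all: by end_near. Qed.

Lemma cuspon_slope_neq0 (x : R) : 0 < x -> phi' x != 0.
Proof.
move=> x0; have [/andP[ms _]|/andP[_ sm]] := cuspon_order Hphi.
- by rewrite lt_eqF// (cuspon_decreasing Hphi ms).
- by rewrite gt_eqF// (cuspon_increasing Hphi sm).
Qed.

Lemma cuspon_first_integral (x : R) : 0 < x ->
  (s - phi x) * phi' x ^+ 2 = (M - phi x) * (phi x - m) ^+ 2.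
Proof.
move=> x0; rewrite (cuspon_ode Hphi); last by rewrite gt_eqF.
rewrite mulrCA divff ?mulr1// subr_eq0.
by case: (cuspon_range x0) => -[_ /andP[h1 h2]]; rewrite ?(gt_eqF h2) ?(lt_eqF h1).
Qed.

(** Differentiate the first integral and cancel the factor [phi'], which has no
    zero on the half-line. *)
Lemma cuspon_second_order (x : R) : 0 < x ->
  2 * (s - phi x) * derive1 phi' x - phi' x ^+ 2 =
  2 * (M - phi x) * (phi x - m) - (phi x - m) ^+ 2.
Proof.
move=> x0; have xn0 : x != 0 by rewrite gt_eqF.
have d1 := cuspon_is_derive xn0; have d2 := cuspon_is_derive2 xn0.
pose L := (cst s - phi) * (phi' * phi').
pose K := (cst M - phi) * ((phi - cst m) * (phi - cst m)).
have dL := is_deriveM (is_deriveB (is_derive_cst s x 1) d1) (is_deriveM d2 d2).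
have dphim := is_deriveB d1 (is_derive_cst m x 1).
have dK := is_deriveM (is_deriveB (is_derive_cst M x 1) d1) (is_deriveM dphim dphim).
have dL' : is_derive x 1 K ((cst s - phi) x *: (phi' x *: derive1 phi' x + phi' x *: derive1 phi' x)
    + (phi' * phi') x *: (0 - phi' x)).
  apply: (near_eq_is_derive _ dL); near=> y.
  have y0 : 0 < y by near: y; exact: lt_nbhsr.
  by have := cuspon_first_integral y0; rewrite /L /K !expr2.
have := derive_val (is_derive := dK); rewrite (derive_val (is_derive := dL')) /GRing.scale/= => E.
apply: (mulfI (cuspon_slope_neq0 x0)); rewrite !expr2.
by move: E; clear; rewrite !fctE; move: (phi x) (phi' x) (derive1 _ _) => a b d E; lra.
Unshelve. all: by end_near. Qed.

(** The half-length [l] of the plateau is [0] for a cuspon; the relation [Hl]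
    between the parameters is the one imposed on stumpons, so it is asked for
    only when there is a plateau. *)
Variable l : R.
Hypothesis l0 : 0 <= l.
Hypothesis Hl : 0 < l -> - (M * m) - (M + m) * (s - M - m) = s ^+ 2.

Definition wave_profile : R -> R := stumpon_profile s l phi.
Local Notation psi := wave_profile.

(** At the corners the one-sided slope is infinite; the value [0] there is a
    convention. *)
Definition wave_slope (x : R) : R :=
  if `|x| <= l then 0 else Num.sg x * phi' (`|x| - l).
Local Notation psi' := wave_slope.

Lemma wave_profileE x : psi x = phi (Num.max (`|x| - l) 0).
Proof.
rewrite /psi /stumpon_profile; case: ltP => xl.
  by rewrite max_r ?subr_le0 ?ltW// (cuspon_crest Hphi).
by rewrite max_l// subr_ge0.
Qed.

Lemma wave_profile_plateau x : `|x| <= l -> psi x = s.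
Proof. by move=> xl; rewrite wave_profileE max_r ?subr_le0// (cuspon_crest Hphi). Qed.

Lemma wave_profile_outside x : l < `|x| -> psi x = phi (`|x| - l).
Proof. by move=> xl; rewrite wave_profileE max_l// subr_ge0 ltW. Qed.

Lemma wave_profileN x : psi (- x) = psi x.
Proof. by rewrite !wave_profileE normrN. Qed.

Lemma wave_slope_plateau x : `|x| <= l -> psi' x = 0.
Proof. by rewrite /psi' => ->. Qed.

Lemma wave_slope_right x : l < x -> psi' x = phi' (x - l).
Proof.
move=> lx; have x0 : 0 < x by exact: le_lt_trans lx.
by rewrite /psi' gtr0_norm// leNgt lx gtr0_sg// mul1r.
Qed.

Lemma wave_slopeN x : psi' (- x) = - psi' x.
Proof. by rewrite /psi' normrN sgrN; case: ifP; rewrite ?oppr0// mulNr. Qed.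

Lemma continuous_wave_profile : continuous psi.
Proof.
rewrite (_ : psi = phi \o (fun x => Num.max (`|x| - l) 0)); last first.
  by apply/funext => x; exact: wave_profileE.
move=> x; apply: continuous_comp; last exact: cuspon_continuous Hphi _.
apply: (@continuous_max _ _ (fun x : R => `|x| - l) (cst 0) x); last exact: cvg_cst.
by apply: cvgB; [exact: norm_continuous|exact: cvg_cst].
Qed.

Lemma wave_profile_range x : `|psi x| <= `|m| + `|s|.
Proof.
have [xl|xl] := leP `|x| l; first by rewrite wave_profile_plateau// lerDr.
rewrite wave_profile_outside//.
have : 0 < `|x| - l by rewrite subr_gt0.
move/cuspon_range; case=> -[_ /andP[h1 h2]].
- rewrite ler_norml; apply/andP; split.
    by have := ler_norm (- m); have := normr_ge0 s; rewrite normrN; lra.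
  by have := ler_norm s; have := normr_ge0 m; lra.
- rewrite ler_norml; apply/andP; split.
    by have := ler_norm (- s); have := normr_ge0 m; rewrite normrN; lra.
  by have := ler_norm m; have := normr_ge0 s; lra.
Qed.

Lemma cvg_wave_profiley : psi x @[x --> +oo] --> m.
Proof.
have h : phi (x - l) @[x --> +oo] --> m.
  by have := cuspon_limit Hphi; apply: cvg_comp; exact: cvg_addrr.
apply: cvg_trans h; apply: near_eq_cvg; near=> x.
have lx : l < x by near: x; apply: nbhs_pinfty_gt; rewrite num_real.
have x0 : 0 < x by exact: le_lt_trans lx.
by rewrite wave_profile_outside gtr0_norm.
Unshelve. all: by end_near. Qed.

Lemma cvg_wave_profileNy : psi x @[x --> -oo] --> m.
Proof.
apply/cvgNy_compNP; rewrite (_ : psi \o -%R = psi); first exact: cvg_wave_profiley.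
by apply/funext => x; exact: wave_profileN.
Qed.

(** Off the plateau the profile satisfies the first integral of the cuspon, on
    it both sides vanish. *)
Lemma wave_first_integral x :
  (s - psi x) * psi' x ^+ 2 = if l < `|x| then (M - psi x) * (psi x - m) ^+ 2 else 0.
Proof.
have [xl|xl] := leP `|x| l.
  by rewrite wave_profile_plateau// subrr mul0r.
rewrite wave_profile_outside// -cuspon_first_integral ?subr_gt0//.
rewrite /psi' leNgt xl/= exprMn sqr_sg; case: eqP => [x0|_]; last by rewrite mul1r.
by move: xl; rewrite x0 normr0 ltNge l0.
Qed.

(** On the right of the plateau the profile is a translate of [phi]; the left
    side follows by reflection, under which the equation is invariant. *)
Lemma wave_slope_deriv (x : R) : l < `|x| -> exists psi'' : R,
  [/\ is_derive x 1 psi (psi' x), is_derive x 1 psi' psi'' &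
   2 * (s - psi x) * psi'' - psi' x ^+ 2 = 2 * (M - psi x) * (psi x - m) - (psi x - m) ^+ 2].
Proof.
have right (y : R) : l < y -> exists psi'' : R,
  [/\ is_derive y 1 psi (psi' y), is_derive y 1 psi' psi'' &
   2 * (s - psi y) * psi'' - psi' y ^+ 2 = 2 * (M - psi y) * (psi y - m) - (psi y - m) ^+ 2].
  move=> ly; have y0 : 0 < y by exact: le_lt_trans ly.
  have yl0 : 0 < y - l by rewrite subr_gt0.
  have yln : y - l != 0 by rewrite gt_eqF.
  have dsh : is_derive y 1 (fun z : R => z - l) 1.
    by apply: is_derive_eq; rewrite subr0.
  have ny : \near y, l < y by exact: lt_nbhsr.
  exists (derive1 phi' (y - l)); split.
  - rewrite wave_slope_right//.
    have := @is_derive1_comp _ phi (fun z : R => z - l) y _ _ (cuspon_is_derive yln) dsh.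
    rewrite mulr1; apply: near_eq_is_derive; near=> z.
    have lz : l < z by near: z.
    have z0 : 0 < z by exact: le_lt_trans lz.
    by rewrite wave_profile_outside ?gtr0_norm.
  - have := @is_derive1_comp _ phi' (fun z : R => z - l) y _ _ (cuspon_is_derive2 yln) dsh.
    rewrite mulr1; apply: near_eq_is_derive; near=> z.
    have lz : l < z by near: z.
    by rewrite wave_slope_right.
  - by rewrite wave_profile_outside gtr0_norm// wave_slope_right//; exact: cuspon_second_order.
move=> xl; have [x0|x0] := leP 0 x.
  by apply: right; rewrite ger0_norm in xl.
have [|c [d1 d2 E]] := right (- x); first by rewrite ltr0_norm in xl.
have dN : is_derive x 1 (-%R : R -> R) (- 1) by exact: is_deriveNid.
exists c; split.
- have := @is_derive1_comp _ psi -%R x _ _ d1 dN.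
  rewrite wave_slopeN mulrNN mulr1; congr (is_derive _ _ _ _); apply/funext => z /=.
  exact: wave_profileN.
- have := is_deriveN (@is_derive1_comp _ psi' -%R x _ _ d2 dN).
  rewrite mulrN1 opprK; congr (is_derive _ _ _ _); apply/funext => z /=.
  by rewrite fctE/= wave_slopeN opprK.
- by move: E; rewrite wave_profileN wave_slopeN sqrrN.
Unshelve. all: by end_near. Qed.

(** The integration constant for which the pressure tends to [m ^+ 2] at
    infinity, as [P - P'' = psi^2 + psi'^2 / 2] requires there. *)
Let c : R := - (m ^+ 2 / 2) - M * m.

(** The travelling wave equation [- s psi' + psi psi' + P' = 0] integrated
    once. *)
Definition wave_pressure (x : R) : R := s * psi x - psi x ^+ 2 / 2 + c.

Definition wave_pressure_slope (x : R) : R := (s - psi x) * psi' x.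

Definition wave_source (x : R) : R := psi x ^+ 2 + 1 / 2 * psi' x ^+ 2.

(** The stumpon relation is what makes the constant pressure [s^2 / 2 + c] of
    the plateau agree with the constant source [s^2]. *)
Lemma plateau_constants : 0 < l -> s ^+ 2 = 2 * c.
Proof.
move=> /Hl; have := cuspon_param Hphi; rewrite /c => h <-.
have -> : s = 2 * m + M by lra.
rewrite !expr2; lra.
Qed.

Lemma wave_plateau_deriv (x : R) : `|x| < l ->
  is_derive x 1 psi 0 /\ is_derive x 1 psi' 0.
Proof.
move=> xl; split.
- apply: (near_eq_is_derive _ (is_derive_cst s x 1)).
  near=> y; rewrite wave_profile_plateau// ltW//; near: y; exact: near_norm_lt.
- apply: (near_eq_is_derive _ (is_derive_cst 0 x 1)).
  near=> y; rewrite wave_slope_plateau// ltW//; near: y; exact: near_norm_lt.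
Unshelve. all: by end_near. Qed.

Lemma off_corners (x : R) : x \notin [:: - l; l] -> `|x| < l \/ l < `|x|.
Proof.
rewrite !inE negb_or => /andP[h1 h2].
have : `|x| != l.
  apply: contraNneq h1 => E; move: E h2; have [x0|x0] := leP 0 x.
    by rewrite ger0_norm// => ->; rewrite eqxx.
  by rewrite ltr0_norm// => <- _; rewrite opprK.
by rewrite neq_lt => /orP[]; [left|right].
Qed.

Lemma wave_slope_continuous (x : R) : x \notin [:: - l; l] -> {for x, continuous psi'}.
Proof.
move=> /off_corners[/wave_plateau_deriv[_ d]|/wave_slope_deriv[d'' [_ d _]]];
by apply/differentiable_continuous/derivable1_diffP; exact: ex_derive.
Qed.

(** The equation [P - P'' = psi^2 + psi'^2 / 2]: off the plateau it combines the
    second order equation with the choice of [c], on the plateau it is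
    [plateau_constants]. *)
Lemma wave_pressure_deriv (x : R) : x \notin [:: - l; l] ->
  [/\ is_derive x 1 psi (psi' x), is_derive x 1 wave_pressure (wave_pressure_slope x) &
   is_derive x 1 wave_pressure_slope (wave_pressure x - wave_source x)].
Proof.
move=> xS.
have [psi'' [d1 d2 E]] : exists psi'' : R,
    [/\ is_derive x 1 psi (psi' x), is_derive x 1 psi' psi'' &
     - psi' x ^+ 2 + (s - psi x) * psi'' = wave_pressure x - wave_source x].
  rewrite /wave_pressure /wave_source; case: (off_corners xS) => [xl|xl].
    have [d1 d2] := wave_plateau_deriv xl.
    exists 0; rewrite wave_slope_plateau ?ltW//; split => //.
    rewrite wave_profile_plateau ?ltW// subrr mul0r expr0n/= mulr0 !addr0 oppr0.
    have := plateau_constants (le_lt_trans (normr_ge0 x) xl); rewrite !expr2; lra.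
  have [d'' [d1 d2 E]] := wave_slope_deriv xl; exists d''; split => //.
  have := cuspon_param Hphi; move: E; rewrite /c !expr2 => E P.
  have Es : s = 2 * m + M by lra.
  by move: E; rewrite Es; lra.
split => //.
- have := is_deriveD (is_deriveB (is_deriveZ s d1) (is_deriveZ (2^-1) (is_deriveM d1 d1))) (is_derive_cst c x 1).
  rewrite (_ : s *: psi - 2^-1 *: (psi * psi) + cst c = wave_pressure).
    rewrite /wave_pressure_slope /GRing.scale/= => d.
    by apply: (is_derive_congr d); lra.
  by apply/funext => y; rewrite /wave_pressure !fctE /GRing.scale/= expr2; lra.
- have := is_deriveM (is_deriveB (is_derive_cst s x 1) d1) d2.
  rewrite (_ : (cst s - psi) * psi' = wave_pressure_slope)//.
  move=> d; apply: (is_derive_congr d).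
  rewrite -E /GRing.scale/= !fctE; ring.
Qed.

(** Squaring removes the singularity: the pressure slope has a polynomial in the
    profile as its square, and so is controlled at the corners and at infinity,
    where that polynomial vanishes. *)
Lemma wave_pressure_slope_sqr x :
  wave_pressure_slope x ^+ 2 = (s - psi x) * (M - psi x) * (psi x - m) ^+ 2.
Proof.
rewrite /wave_pressure_slope exprMn expr2 -mulrA wave_first_integral.
case: ltP => [_|xl]; first by rewrite mulrA.
by rewrite wave_profile_plateau// subrr !mul0r.
Qed.

Let W (w : R) : R := (s - w) * (M - w) * (w - m) ^+ 2.

Let continuous_W : continuous W.
Proof.
move=> w; apply: cvgM; [apply: cvgM; apply: cvgB; [exact: cvg_cst|exact: cvg_id|exact: cvg_cst|exact: cvg_id]|].
by apply: cvg_sqr; apply: cvgB; [exact: cvg_id|exact: cvg_cst].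
Qed.

(** This excludes point masses in [P''] at the corners: there [P'] has no jump. *)
Lemma continuous_wave_pressure_slope : continuous wave_pressure_slope.
Proof.
move=> x; have [xS|xS] := boolP (x \in [:: - l; l]); last first.
  have [_ _ d] := wave_pressure_deriv xS.
  by apply/differentiable_continuous/derivable1_diffP; exact: ex_derive.
have xl : `|x| <= l.
  by move: xS; rewrite !inE => /orP[] /eqP ->; rewrite ?normrN ger0_norm.
rewrite /continuous_at {2}/wave_pressure_slope wave_profile_plateau// subrr mul0r.
apply: cvg_sqr0; under eq_fun do rewrite wave_pressure_slope_sqr -/(W _).
have := cvg_comp _ _ (@continuous_wave_profile x) (@continuous_W _).
by rewrite wave_profile_plateau// /W subrr !mul0r.
Qed.

Lemma continuous_wave_pressure : continuous wave_pressure.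
Proof.
have cp := continuous_wave_profile.
move=> x; apply: cvgD; last exact: cvg_cst.
by apply: cvgB; apply: cvgM; [exact: cvg_cst|exact: cp|apply: cvg_sqr; exact: cp|exact: cvg_cst].
Qed.

Lemma wave_pressure_cvg (F : set_system R) : Filter F -> psi x @[x --> F] --> m ->
  wave_pressure x @[x --> F] --> m ^+ 2 /\ wave_pressure_slope x @[x --> F] --> (0 : R).
Proof.
move=> FF psim; split.
  have -> : m ^+ 2 = s * m - m ^+ 2 / 2 + c.
    by rewrite /c; have := cuspon_param Hphi => h; rewrite !expr2 (_ : s = 2 * m + M); lra.
  apply: cvgD; last exact: cvg_cst.
  by apply: cvgB; apply: cvgM; [exact: cvg_cst|exact: psim|apply: cvg_sqr; exact: psim|exact: cvg_cst].
apply: cvg_sqr0; under eq_fun do rewrite wave_pressure_slope_sqr -/(W _).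
have := cvg_comp _ _ psim (@continuous_W _).
by rewrite /W subrr expr0n mulr0.
Qed.

Lemma measurable_wave_profile : measurable_fun [set: measurableTypeR R] psi.
Proof. by apply: continuous_measurable_fun; exact: continuous_wave_profile. Qed.

Lemma measurable_wave_slope : measurable_fun [set: measurableTypeR R] psi'.
Proof. exact: measurable_continuous_off wave_slope_continuous. Qed.

Lemma measurable_wave_source : measurable_fun [set: measurableTypeR R] wave_source.
Proof.
apply: measurable_funD; first exact: measurable_funX measurable_wave_profile.
by apply: measurable_funM => //; exact: measurable_funX measurable_wave_slope.
Qed.

Lemma wave_source_ge0 x : 0 <= wave_source x.
Proof. by rewrite addr_ge0 ?sqr_ge0// mulr_ge0 ?sqr_ge0. Qed.

Lemma wave_source_continuous (x : R) : x \notin [:: - l; l] -> {for x, continuous wave_source}.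
Proof.
move=> xS; apply: cvgD; first by apply: cvg_sqr; exact: continuous_wave_profile.
by apply: cvgM; [exact: cvg_cst|apply: cvg_sqr; exact: wave_slope_continuous].
Qed.

(** On each side of [y] the integrand has an explicit primitive, because
    [wave_pressure - wave_pressure''] is [wave_source]; the two primitives are
    glued at [y]. *)
Lemma integral_wave_source (y : R) :
  (\int[mu]_z (1 / 2 * expR (- `|y - z|) * wave_source z)%:E = (wave_pressure y)%:E)%E.
Proof.
have cQ := continuous_wave_pressure; have cQ' := continuous_wave_pressure_slope.
(* [Gl] and [Gr] are primitives because
   [(e^z (P - P'))' = e^z (P - P'')] and [(e^(-z) (P + P'))' = - e^(-z) (P - P'')];
   the additive constants make [Gl] vanish at minus infinity and agree with [Gr]
   at [y]. *)
pose Gl z := 1 / 2 * expR (z - y) * (wave_pressure z - wave_pressure_slope z).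
pose Gr z := wave_pressure y - 1 / 2 * expR (y - z) * (wave_pressure z + wave_pressure_slope z).
pose G z := if z <= y then Gl z else Gr z.
have Gly : Gl y = Gr y by rewrite /Gl /Gr subrr expR0; lra.
have cGl : continuous Gl.
  move=> z; apply: cvgM; last by apply: cvgB; [exact: cQ|exact: cQ'].
  apply: cvgM; first exact: cvg_cst.
  apply: continuous_comp; last exact: continuous_expR.
  by apply: cvgB; [exact: cvg_id|exact: cvg_cst].
have cGr : continuous Gr.
  move=> z; apply: cvgB; first exact: cvg_cst.
  apply: cvgM; last by apply: cvgD; [exact: cQ|exact: cQ'].
  apply: cvgM; first exact: cvg_cst.
  apply: continuous_comp; last exact: continuous_expR.
  by apply: cvgB; [exact: cvg_cst|exact: cvg_id].
have cexp : continuous (fun z : R => expR (- `|y - z|)).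
  move=> z; apply: (cvg_comp (fun z : R => - `|y - z|) expR); last exact: continuous_expR.
  by apply: cvgN; apply: cvg_norm; apply: cvgB; [exact: cvg_cst|exact: cvg_id].
have GE : G = fun z => Gl (Num.min z y) + Gr (Num.max z y) - Gl y.
  apply/funext => z; rewrite /G; case: leP => zy.
    by rewrite -Gly; ring.
  by ring.
have dexpl (z : R) : is_derive z 1 (fun w => 1 / 2 * expR (w - y)) (1 / 2 * expR (z - y)).
  have d : is_derive z 1 (fun w : R => w - y) 1 by apply: is_derive_eq; rewrite subr0.
  have := @is_derive1_comp _ expR (fun w : R => w - y) z _ _ (is_derive_expR _) d.
  by rewrite mulr1; exact: is_deriveZ.
have dexpr (z : R) : is_derive z 1 (fun w => 1 / 2 * expR (y - w)) (1 / 2 * - expR (y - z)).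
  have d : is_derive z 1 (fun w : R => y - w) (- 1).
    by apply: (is_derive_congr (is_deriveB (is_derive_cst y z 1) (is_derive_id z 1))); rewrite sub0r.
  have := @is_derive1_comp _ expR (fun w : R => y - w) z _ _ (is_derive_expR _) d.
  by rewrite mulrN1; exact: is_deriveZ.
rewrite -[wave_pressure y]subr0; apply: (ge0_FTC_line (S := [:: y; - l; l]) (F := G)).
- have cmin : continuous (fun z : R => Num.min z y).
    by move=> z; apply: (@continuous_min _ _ (id : R -> R) (cst y)); [exact: cvg_id|exact: cvg_cst].
  have cmax : continuous (fun z : R => Num.max z y).
    by move=> z; apply: (@continuous_max _ _ (id : R -> R) (cst y)); [exact: cvg_id|exact: cvg_cst].
  rewrite GE => z; apply: cvgB; last exact: cvg_cst.
  by apply: cvgD; [exact: (cvg_comp _ Gl (cmin z) (cGl _))|exact: (cvg_comp _ Gr (cmax z) (cGr _))].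
- move=> z; rewrite inE negb_or => /andP[zy zS]; split; last first.
    apply: cvgM; last exact: wave_source_continuous.
    by apply: cvgM; [exact: cvg_cst|exact: cexp].
  have [_ d1 d2] := wave_pressure_deriv zS.
  move: zy; rewrite neq_lt => /orP[zy|yz].
  + apply: (@near_eq_is_derive _ _ _ Gl).
      by near=> w; rewrite /G ifT// ltW//; near: w; exact: lt_nbhsl.
    have := is_deriveM (dexpl z) (is_deriveB d1 d2).
    move=> d; apply: (is_derive_congr d).
    have -> : - `|y - z| = z - y by rewrite gtr0_norm ?subr_gt0// opprB.
    rewrite !fctE /GRing.scale/=; lra.
  + apply: (@near_eq_is_derive _ _ _ Gr).
      by near=> w; rewrite /G ifF// leNgt; apply/negbTE; rewrite negbK; near: w; exact: lt_nbhsr.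
    have := is_deriveB (is_derive_cst (wave_pressure y) z 1)
       (is_deriveM (dexpr z) (is_deriveD d1 d2)).
    move=> d; apply: (is_derive_congr d).
    have -> : - `|y - z| = y - z by rewrite ltr0_norm ?subr_lt0// opprK.
    rewrite !fctE /GRing.scale/=; lra.
- apply: measurable_funM; last exact: measurable_wave_source.
  apply: measurable_funM => //; exact: continuous_measurable_fun.
- by move=> z; rewrite !mulr_ge0 ?expR_ge0 ?wave_source_ge0.
- have [Qm Q'0] := wave_pressure_cvg _ cvg_wave_profileNy.
  have h0 : 1 / 2 * expR (- y) * expR (- z) @[z --> +oo] --> (0 : R).
    by rewrite -[X in _ --> X](mulr0 (1 / 2 * expR (- y))); apply: cvgMr; exact: cvgr_expR.
  have e0 : 1 / 2 * expR (z - y) @[z --> -oo] --> (0 : R).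
    apply/cvgNy_compNP; rewrite (_ : _ \o _ = fun z => 1 / 2 * expR (- y) * expR (- z))//.
    by apply/funext => z /=; rewrite -[RHS]mulrA -expRD; congr (_ * expR _); ring.
  have Gl0 : Gl z @[z --> -oo] --> (0 : R).
    rewrite -[X in _ --> X](mul0r (m ^+ 2 - 0)); apply: cvgM => //; exact: cvgB.
  apply: cvg_trans Gl0; apply: near_eq_cvg; near=> z.
  rewrite /G ifT//; near: z; apply: nbhs_ninfty_le; rewrite num_real.
- have [Qm Q'0] := wave_pressure_cvg _ cvg_wave_profiley.
  have e0 : 1 / 2 * expR (y - z) @[z --> +oo] --> (0 : R).
    rewrite (_ : (fun z => _) = fun z => 1 / 2 * expR y * expR (- z)); last first.
      by apply/funext => z /=; rewrite -[RHS]mulrA -expRD.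
    by rewrite -[X in _ --> X](mulr0 (1 / 2 * expR y)); apply: cvgMr; exact: cvgr_expR.
  have Gr0 : Gr z @[z --> +oo] --> wave_pressure y.
    rewrite -[X in _ --> X](subr0 (wave_pressure y)); apply: cvgB; first exact: cvg_cst.
    rewrite -[X in _ --> X](mul0r (m ^+ 2 + 0)); apply: cvgM => //; exact: cvgD.
  apply: cvg_trans Gr0; apply: near_eq_cvg; near=> z.
  rewrite /G ifF//; apply/negbTE; rewrite -ltNge; near: z.
  by apply: nbhs_pinfty_gt; rewrite num_real.
Unshelve. all: by end_near. Qed.

(** On [[- N, N]] the kernel [e^(- |z|) / 2] is bounded below, and its integral
    against the source is finite by [integral_wave_source] at [0]. *)
Lemma loc_integrable_wave_slope_sqr : loc_integrable (fun x => psi' x ^+ 2).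
Proof.
move=> N.
have mk : measurable_fun [set: measurableTypeR R]
    (fun z => 1 / 2 * expR (- `|0 - z|) * wave_source z).
  apply: measurable_funM; last exact: measurable_wave_source.
  apply: measurable_funM => //; apply: continuous_measurable_fun => z.
  apply: (cvg_comp (fun z : R => - `|0 - z|) expR); last exact: continuous_expR.
  by apply: cvgN; apply: cvg_norm; apply: cvgB; [exact: cvg_cst|exact: cvg_id].
have ik : mu.-integrable setT (fun z => (1 / 2 * expR (- `|0 - z|) * wave_source z)%:E).
  apply/integrableP; split; first exact/measurable_EFinP.
  under eq_integral => z _.
    rewrite gee0_abs; last by rewrite lee_fin !mulr_ge0 ?expR_ge0 ?wave_source_ge0.
    over.
  by rewrite integral_wave_source ltry.
have ik' := integrableZl measurableT (4 * expR N) ik.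
have mN : measurable (`[- N, N]%classic : set (measurableTypeR R)) by exact: measurable_itv.
apply: (le_integrable mN _ _ (integrableS measurableT mN (@subsetT _ _) ik')).
  apply/measurable_EFinP; apply: measurable_funS (measurable_funX 2 measurable_wave_slope) => //.
move=> x; rewrite /= in_itv/= -ler_norml => xN; rewrite lee_fin.
rewrite (ger0_norm (sqr_ge0 _)) [X in _ <= X]ger0_norm; last first.
  by rewrite !mulr_ge0 ?expR_ge0 ?wave_source_ge0.
have h : 1 <= expR N * expR (- `|0 - x|).
  by rewrite -expRD -expR0 ler_expR sub0r normrN subr_ge0.
have := sqr_ge0 (psi' x); have := sqr_ge0 (psi x); rewrite /wave_source.
move: (psi x ^+ 2) (psi' x ^+ 2) h => p q h p0 q0.
rewrite [X in _ <= X](_ : _ = (expR N * expR (- `|0 - x|)) * (2 * p + q)); last by field.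
by move: h; move: (_ * _) => e; nra.
Qed.

Lemma loc_integrable_wave_profile : loc_integrable psi.
Proof. exact: loc_integrable_bounded measurable_wave_profile wave_profile_range. Qed.

Lemma loc_integrable_wave_slope : loc_integrable psi'.
Proof.
apply: (loc_integrableW (k := fun x => 1 + psi' x ^+ 2)) measurable_wave_slope _ _.
  move=> y; rewrite (ger0_norm (addr_ge0 ler01 (sqr_ge0 _))) -real_normK ?num_real//.
  by have := normr_ge0 (psi' y); move: `|_| => a a0; nra.
apply: loc_integrableD loc_integrable_wave_slope_sqr.
by apply: (@loc_integrable_bounded _ _ 1) => // y; rewrite normr1.
Qed.

Definition wave_energy (x : R) : R := psi x ^+ 2 + psi' x ^+ 2.

Lemma measurable_wave_energy : measurable_fun [set: measurableTypeR R] wave_energy.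
Proof.
by apply: measurable_funD; [exact: measurable_funX measurable_wave_profile|
  exact: measurable_funX measurable_wave_slope].
Qed.

Lemma loc_integrable_wave_energy : loc_integrable wave_energy.
Proof.
apply: loc_integrableD loc_integrable_wave_slope_sqr.
apply: (@loc_integrable_bounded _ _ ((`|m| + `|s|) ^+ 2)).
  exact: measurable_funX measurable_wave_profile.
by move=> y; rewrite normrX lerXn2r ?nnegrE ?addr_ge0//; exact: wave_profile_range.
Qed.

(** The flux [psi e - psi^3 + 2 P psi] of the conservation law, minus [s] times
    its density [e = psi^2 + psi'^2]: the flux seen in the moving frame. *)
Definition wave_flux (x : R) : R :=
  (psi x - s) * wave_energy x - psi x ^+ 3 + 2 * wave_pressure x * psi x.

Let k : R := - (M * m ^+ 2).

(** The first integral turns [(psi - s) psi'^2] into a polynomial in [psi], and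
    all the nonconstant terms cancel. *)
Lemma wave_flux_outside x : l < `|x| -> wave_flux x = k.
Proof.
move=> xl; have := wave_first_integral x; rewrite xl => E.
have P := cuspon_param Hphi; have Es : s = 2 * m + M by lra.
rewrite /wave_flux /wave_energy /wave_pressure /c /k.
rewrite mulrDr -[(psi x - s) * psi' x ^+ 2]opprK -mulNr opprB E Es.
by move: (psi x) => p; rewrite !(expr2, exprS, expr0); lra.
Qed.

(** On the plateau [2 P = 2 s^2] by [plateau_constants], and the density
    cancels. *)
Lemma wave_flux_plateau x : `|x| < l -> wave_flux x = s ^+ 3.
Proof.
move=> xl; have := plateau_constants (le_lt_trans (normr_ge0 x) xl).
rewrite /wave_flux /wave_pressure wave_profile_plateau ?ltW// subrr mul0r => h.
rewrite (_ : s * s - s ^+ 2 / 2 + c = s ^+ 2); first by ring.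
by move: h; rewrite !expr2; lra.
Qed.

(** The product of the profile with a test function is a continuous primitive
    across the corners, so the classical slope is the weak derivative. *)
Lemma wave_by_parts N (b b' : R -> R) : 0 <= N -> C1_compact N b b' ->
  (\int[mu]_y (psi y * b' y + psi' y * b y)%:E = 0)%E.
Proof.
move=> N0 bN; have cb := C1_compact_continuous bN; have [bb' cb' b0] := bN.
have [C C0 hC] := C1_compact_bounded bN.
have mb := continuous_measurable_fun cb; have mb' := continuous_measurable_fun cb'.
have cp := continuous_wave_profile.
rewrite (FTC_compact (S := [:: - l; l]) (F := psi * b) N0).
- have [bN0 _] := b0 N (ler_norm N).
  have [bNN0 _] : b (- N) = 0 /\ b' (- N) = 0 by apply: b0; rewrite normrN ler_norm.
  by rewrite !fctE bN0 bNN0 !mulr0 subrr.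
- by move=> y; apply: cvgM; [exact: cp|exact: cb].
- move=> y yS; have [d1 _ _] := wave_pressure_deriv yS; split.
    have := is_deriveM d1 (bb' y); move=> d; apply: (is_derive_congr d).
    by rewrite /GRing.scale/= [b y * _]mulrC.
  apply: cvgD; first by apply: cvgM; [exact: cp|exact: cb'].
  by apply: cvgM; [exact: wave_slope_continuous|exact: cb].
- apply: measurable_funD; apply: measurable_funM => //.
  + exact: measurable_wave_profile.
  + exact: measurable_wave_slope.
- apply: loc_integrableD.
  + apply: (loc_integrableM (C := C)) => //; last by move=> y; have [] := hC y.
    * exact: measurable_wave_profile.
    * exact: loc_integrable_wave_profile.
  + apply: (loc_integrableM (C := C)) => //; last by move=> y; have [] := hC y.
    * exact: measurable_wave_slope.
    * exact: loc_integrable_wave_slope.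
- by move=> y yN; have [-> ->] := b0 y (ltW yN); rewrite !mulr0 addr0.
Qed.

Lemma measurable_wave_pressure : measurable_fun [set: measurableTypeR R] wave_pressure.
Proof. by apply: continuous_measurable_fun; exact: continuous_wave_pressure. Qed.

Lemma measurable_wave_flux : measurable_fun [set: measurableTypeR R] wave_flux.
Proof.
have mp := measurable_wave_profile.
apply: measurable_funD; last first.
  by apply: measurable_funM => //; apply: measurable_funM => //; exact: measurable_wave_pressure.
apply: measurable_funB; last exact: measurable_funX.
by apply: measurable_funM; [exact: measurable_funB|exact: measurable_wave_energy].
Qed.

Lemma wave_flux_bounded : exists C, forall y, `|wave_flux y| <= C.
Proof.
exists (`|k| + `|- s ^+ 3 + 2 * (s * s - s ^+ 2 / 2 + c) * s|) => y.
have [yl|yl] := leP `|y| l; last by rewrite wave_flux_outside// lerDl.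
by rewrite /wave_flux /wave_pressure wave_profile_plateau// subrr mul0r sub0r lerDr.
Qed.

Lemma loc_integrable_wave_flux : loc_integrable wave_flux.
Proof.
by have [C hC] := wave_flux_bounded; exact: loc_integrable_bounded measurable_wave_flux hC.
Qed.

(** In the moving frame the flux is the constant [k] outside the plateau and
    [s ^+ 3] on it, so pairing it with a derivative only sees the two jumps. *)
Lemma wave_flux_pairing N (b b' : R -> R) : 0 <= N -> C1_compact N b b' ->
  (\int[mu]_y (wave_flux y * b' y)%:E = ((s ^+ 3 - k) * (b l - b (- l)))%:E)%E.
Proof.
move=> N0 bN; have cb := C1_compact_continuous bN; have [bb' cb' b0] := bN.
have [C C0 hC] := C1_compact_bounded bN.
have mb := continuous_measurable_fun cb; have mb' := continuous_measurable_fun cb'.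
pose clamp y : R := Num.max (- l) (Num.min y l).
have cclamp : continuous clamp.
  move=> y; apply: (@continuous_max _ _ (cst (- l)) (fun y : R => Num.min y l)); first exact: cvg_cst.
  by apply: (@continuous_min _ _ (id : R -> R) (cst l)); [exact: cvg_id|exact: cvg_cst].
have ll : - l <= l by rewrite lerNl (le_trans _ l0)// oppr_le0.
have clamp_right y : l <= y -> clamp y = l.
  by move=> ly; rewrite /clamp min_r// max_r.
have clamp_left y : y <= - l -> clamp y = - l.
  by move=> ly; rewrite /clamp min_l ?max_l// (le_trans ly).
have clamp_mid y : `|y| <= l -> clamp y = y.
  by rewrite ler_norml => /andP[h1 h2]; rewrite /clamp min_l ?max_r.
(* [clamp] is the projection to the plateau, so [F] has derivative [k b'] off the
   plateau, [s ^+ 3 * b'] on it, and is continuous. *)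
pose F y := k * b y + (s ^+ 3 - k) * (b (clamp y) - b (- l)).
have Nl0 : 0 <= N + l by rewrite addr_ge0.
have NN : N <= `|N + l| by rewrite ger0_norm// lerDl.
rewrite (FTC_compact (S := [:: - l; l]) (F := F) Nl0).
- have [bN0 _] := b0 (N + l) NN.
  have [bNN0 _] : b (- (N + l)) = 0 /\ b' (- (N + l)) = 0 by apply: b0; rewrite normrN.
  rewrite /F bN0 bNN0 clamp_right ?lerDr// clamp_left; last by rewrite lerN2 lerDr.
  by congr (_%:E); ring.
- have cbc : continuous (b \o clamp) by move=> y; exact: (cvg_comp _ b (cclamp y) (cb _)).
  move=> y; apply: cvgD; first by apply: cvgM; [exact: cvg_cst|exact: cb].
  by apply: cvgM; [exact: cvg_cst|apply: cvgB; [exact: cbc|exact: cvg_cst]].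
- move=> y yS; case: (off_corners yS) => yl; split.
  + rewrite (wave_flux_plateau yl).
    have FE : \near y, (k *: b + (s ^+ 3 - k) *: (b - cst (b (- l)))) y = F y.
      near=> z; rewrite /F clamp_mid//; apply: ltW; near: z; exact: near_norm_lt.
    have d := is_deriveD (is_deriveZ k (bb' y)) (is_deriveZ (s ^+ 3 - k) (is_deriveB (bb' y) (is_derive_cst (b (- l)) y 1))).
    refine (near_eq_is_derive FE (is_derive_congr d _)).
    by rewrite /GRing.scale/=; ring.
  + have : \near y, s ^+ 3 * b' y = wave_flux y * b' y.
      near=> z; rewrite wave_flux_plateau//; near: z; exact: near_norm_lt.
    move=> E; apply: cvg_trans (near_eq_cvg E) _; rewrite (wave_flux_plateau yl).
    by apply: cvgM; [exact: cvg_cst|exact: cb'].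
  + rewrite (wave_flux_outside yl).
    have [ly|ly] : l < y \/ y < - l.
      by move: yl; rewrite ltNge ler_norml negb_and -!ltNge => /orP[]; [right|left].
    * apply: (@near_eq_is_derive _ _ _ (k *: b + cst ((s ^+ 3 - k) * (b l - b (- l))))).
        by near=> z; rewrite /F clamp_right// ltW//; near: z; exact: lt_nbhsr.
      have d := is_deriveD (is_deriveZ k (bb' y)) (is_derive_cst ((s ^+ 3 - k) * (b l - b (- l))) y 1).
      by apply: (is_derive_congr d); rewrite /GRing.scale/=; ring.
    * apply: (@near_eq_is_derive _ _ _ (k *: b)).
        near=> z; rewrite /F clamp_left; first by rewrite subrr mulr0 addr0.
        by apply: ltW; near: z; exact: lt_nbhsl.
  + have E : \near y, k * b' y = wave_flux y * b' y.
      near=> z; congr (_ * _); apply/esym/wave_flux_outside; near: z.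
      exact: (@norm_continuous R R y _ (lt_nbhsr yl)).
    apply: cvg_trans (near_eq_cvg E) _; rewrite (wave_flux_outside yl).
    by apply: cvgM; [exact: cvg_cst|exact: cb'].
- by apply: measurable_funM => //; exact: measurable_wave_flux.
- apply: (loc_integrableM (C := C)) => //; last by move=> y; have [] := hC y.
  + exact: measurable_wave_flux.
  + exact: loc_integrable_wave_flux.
- move=> y yN; have [|_ ->] := b0 y; last by rewrite mulr0.
  by rewrite ltW// (le_lt_trans _ yN)// lerDl.
Unshelve. all: by end_near. Qed.

End profile.

(** * Test functions on the plane *)

Section test_functions.
Context {R : realType}.
Implicit Types (Phi : R * R -> R).

Lemma test_function_continuous Phi : test_function Phi ->
  [/\ continuous Phi, continuous (d_t Phi) & continuous (d_x Phi)].
Proof.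
move=> [sm _]; have [c0 _ _] := sm [::]; have [ct _ _] := sm [:: true].
by have [cx _ _] := sm [:: false]; split; [exact: c0|exact: ct|exact: cx].
Qed.

Lemma test_function_is_derive Phi p : test_function Phi ->
  is_derive p ((1, 0) : R * R) Phi (d_t Phi p) /\ is_derive p ((0, 1) : R * R) Phi (d_x Phi p).
Proof. by move=> [sm _]; have [_ h1 h2] := sm [::]; split; exact/derivableP. Qed.

Definition supported_in_square (N : R) (F : R * R -> R) :=
  forall p, N <= `|p.1| \/ N <= `|p.2| -> F p = 0.

(** Outside the closure of its support, a test function vanishes in a
    neighbourhood, so its derivatives vanish as well. *)
Lemma test_function_support Phi : test_function Phi -> exists2 N : R, 0 <= N &
  [/\ supported_in_square N Phi, supported_in_square N (d_t Phi) & supported_in_square N (d_x Phi)].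
Proof.
move=> [_ cK]; set K := closure _ in cK.
have [C [_ hC]] : bounded_set K by exact: compact_bounded.
pose N := `|C| + 1; have CN : C < N by rewrite (le_lt_trans (ler_norm C))// ltrDl.
have N0 : 0 < N by rewrite ltr_wpDl.
have outK (p : R * R) : N + 1 <= `|p.1| \/ N + 1 <= `|p.2| -> ~ K p.
  move=> hp Kp; have /= := hC N CN p Kp; rewrite prod_normE ge_max => /andP[h1 h2].
  by case: hp => hp; lra.
have near0 (p : R * R) : ~ K p -> \near p, cst 0 p = Phi p.
  move=> Kp; have oK : open (~` K) by apply: closed_openC; exact: closed_closure.
  apply: filterS (open_nbhs_nbhs (conj oK Kp)) => q Kq.
  by apply/esym/eqP/negPn/negP => h; apply: Kq; exact: subset_closure.
exists (N + 1); first by rewrite addr_ge0// ltW.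
split => p /outK/near0 h.
- by have := nbhs_singleton h.
- exact: (derive_val (is_derive := near_eq_is_derive h (is_derive_cst 0 p _))).
- exact: (derive_val (is_derive := near_eq_is_derive h (is_derive_cst 0 p _))).
Qed.

Lemma supported_in_square_bounded (N : R) F : continuous F -> supported_in_square N F ->
  exists C, forall p, `|F p| <= C.
Proof.
move=> cF F0.
have cK : compact (`[- N, N]%classic `*` `[- N, N]%classic : set (R * R)).
  by apply: compact_setX; exact: segment_compact.
have [C _ hC] : exists2 C : R, 0 <= C & forall p, `|F p| <= C.
  apply: bounded_compact_support cK cF _ => p h; apply: F0.
  apply: contrapT => /not_orP[/negP h1 /negP h2]; apply: h; split; rewrite /= in_itv/= -ler_norml.
    by rewrite ltW// ltNge.
  by rewrite ltW// ltNge.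
by exists C.
Qed.

Lemma mean_value (g g' : R -> R) (a h : R) : (forall x : R, is_derive x 1 g (g' x)) ->
  exists2 c, `|c - a| <= `|h| & g (a + h) - g a = g' c * h.
Proof.
move=> gg'.
have cg (b c : R) : {within `[b, c], continuous g}.
  apply: continuous_subspaceT => x; apply/differentiable_continuous/derivable1_diffP.
  by have [] := gg' x.
have [h0|h0|->] := ltgtP h 0; last first.
- by exists a; rewrite ?subrr// addr0 subrr mulr0.
- have ah : a < a + h by rewrite ltrDl.
  have [c /[!in_itv]/= /andP[c1 c2] ->] := @MVT _ g g' a (a + h) ah (fun x _ => gg' x) (cg _ _).
  exists c; last by congr (_ * _); ring.
  by rewrite (gtr0_norm h0) ler_norml; apply/andP; split; lra.
- have ah : a + h < a by rewrite gtrDl.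
  have [c /[!in_itv]/= /andP[c1 c2] E] := @MVT _ g g' (a + h) a ah (fun x _ => gg' x) (cg _ _).
  exists c; last by rewrite -opprB E; ring.
  by rewrite (ltr0_norm h0) ler_norml; apply/andP; split; lra.
Qed.

(** The chain rule along a line, from continuity of the partial derivatives: the
    increment is split into a time step, handled by the mean value theorem and
    continuity of [d_t Phi], and a space step at fixed time. *)
Lemma is_derive_along_line Phi (s x t : R) : test_function Phi ->
  is_derive t 1 (fun t => Phi (t, x + s * t)) (d_t Phi (t, x + s * t) + s * d_x Phi (t, x + s * t)).
Proof.
move=> tPhi; have [cP cPt cPx] := test_function_continuous tPhi.
pose y h := x + s * (h *: (1 : R) + t).
pose A h := h^-1 *: (Phi (h *: (1 : R) + t, y h) - Phi (t, y h)).
pose B h := h^-1 *: (Phi (t, y h) - Phi (t, x + s * t)).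
have At : A h @[h --> 0^'] --> d_t Phi (t, x + s * t).
  apply/cvgrPdist_le => e e0.
  have /cvgrPdist_le/(_ e e0)/nbhs_ballP[d /= d0 hd] := cPt (t, x + s * t).
  near=> h.
  have hn0 : h != 0 by near: h; exact: nbhs_dnbhs_neq.
  have hd' : `|h| < d / (1 + `|s|).
    near: h; apply: dnbhs0_lt; by rewrite divr_gt0// ltr_pwDl.
  have hd1 : `|h| * (1 + `|s|) < d by rewrite -ltr_pdivlMr// ltr_pwDl.
  have [c c1 c2] := @mean_value (fun t => Phi (t, y h)) (fun t => d_t Phi (t, y h)) t h
    (fun t' => (is_derive_tE Phi (t', y h) _).1 (test_function_is_derive (t', y h) tPhi).1).
  have -> : A h = d_t Phi (c, y h).
    by rewrite /A (_ : h *: (1 : R) + t = t + h) ?c2 /GRing.scale/= ?mulr1; [rewrite mulrC mulfK|rewrite addrC].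
  apply: hd; rewrite -ball_normE /= prod_normE /= gt_max /y /GRing.scale/=; apply/andP; split.
    rewrite distrC (le_lt_trans c1)// (le_lt_trans _ hd1)// ler_peMr// lerDl//.
  rewrite (_ : x + s * t - (x + s * (h * 1 + t)) = - (s * h)); last by ring.
  rewrite normrN normrM (le_lt_trans _ hd1)// mulrC ler_wpM2l// lerDr//.
have Bx : B h @[h --> 0^'] --> s * d_x Phi (t, x + s * t).
  have daff : is_derive t 1 (fun t => x + s * t) s.
    have d := is_deriveD (is_derive_cst x t 1) (is_deriveZ s (is_derive_id t 1)).
    by apply: (is_derive_congr d); rewrite /GRing.scale/= mulr1 add0r.
  have d := @is_derive1_comp _ (fun z => Phi (t, z)) (fun t => x + s * t) t _ _
    ((is_derive_xE Phi (t, x + s * t) _).1 (test_function_is_derive (t, x + s * t) tPhi).2) daff.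
  by have := ex_derive (is_derive := d); rewrite /derivable -/(derive _ _ _) (derive_val (is_derive := d)) mulrC.
apply: cvg_is_derive; rewrite (_ : (fun h => _) = A + B); first exact: cvgD.
by apply/funext => h; rewrite /A /B fctE -scalerDr addrA subrK.
Unshelve. all: by end_near. Qed.

End test_functions.

(** * The moving frame *)

Section moving_frame.
Context {R : realType}.
Variables (x0 s : R).
Notation mu := (@lebesgue_measure R).
Notation plane := (measurableTypeR R * measurableTypeR R)%type.

Lemma continuous_comp_shear (F : R * R -> R) : continuous F ->
  continuous (fun p : R * R => F (shear x0 s p)).
Proof.
move=> cF p; apply: (cvg_comp (fun p : R * R => (p.1, p.2 + x0 + s * p.1)) F); last exact: (cF (_, _)).
apply: (cvg_pair (G := nbhs p.1) (H := nbhs (p.2 + x0 + s * p.1))); first exact: cvg_fst.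
apply: cvgD; first by apply: cvgD; [exact: cvg_snd|exact: cvg_cst].
by apply: cvgM; [exact: cvg_cst|exact: cvg_fst].
Qed.

(** In the moving frame, the preimage of the square of half-side [N] is contained
    in the square of this half-side. *)
Definition moving_radius (N : R) : R := N + `|x0| + `|s| * N.

Lemma moving_radius_ge (N : R) : 0 <= N -> N <= moving_radius N.
Proof. by move=> N0; rewrite /moving_radius -addrA lerDl addr_ge0// mulr_ge0. Qed.

Lemma supported_shear (N : R) (F : R * R -> R) : 0 <= N -> supported_in_square N F ->
  supported_in_square (moving_radius N) (fun p => F (shear x0 s p)).
Proof.
move=> N0 F0 [t y] /= h; apply: F0; rewrite /shear/=.
have [tN|tN] := leP N `|t|; [by left|right].
case: h => [h|h]; first by move: tN; rewrite ltNge (le_trans (moving_radius_ge N0) h).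
have h1 : `|y| <= `|y + x0 + s * t| + `|x0| + `|s * t|.
  have {1}-> : y = y + x0 + s * t - x0 - s * t by ring.
  by apply: le_trans (ler_normB _ _) _; rewrite lerD2r; exact: ler_normB.
have h2 : `|s * t| <= `|s| * N by rewrite normrM ler_wpM2l// ltW.
by move: h h1 h2; rewrite /moving_radius; lra.
Qed.

Lemma integrable_moving (h : R -> R) (F : R * R -> R) (N : R) :
  measurable_fun [set: measurableTypeR R] h -> loc_integrable h ->
  continuous F -> supported_in_square N F ->
  lebesgue_plane.-integrable setT (fun p : plane => (h p.2 * F p)%:E).
Proof.
move=> mh ih cF F0; have [C hC] := supported_in_square_bounded cF F0.
apply: (integrable_box (N := N) (C := C) ih).
- apply: measurable_funM; last exact: continuous_measurable_plane.
  exact: measurableT_comp mh measurable_snd.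
- by move=> t y; rewrite /= normrM mulrC ler_wpM2r.
- move=> t y; rewrite negb_and -!ltNge => /orP[|] hN; rewrite /= F0 ?mulr0//;
    by [left; exact: ltW|right; exact: ltW].
Qed.

(** In the moving frame the factor [h] no longer depends on time. *)
Lemma integral_moving (h : R -> R) (F : R * R -> R) (N : R) : 0 <= N ->
  measurable_fun [set: measurableTypeR R] h -> loc_integrable h ->
  continuous F -> supported_in_square N F ->
  lebesgue_plane.-integrable setT (fun p : plane => (h (p.2 - x0 - s * p.1) * F p)%:E) /\
  (\int[lebesgue_plane]_p (h (p.2 - x0 - s * p.1) * F p)%:E =
   \int[lebesgue_plane]_p (h p.2 * F (shear x0 s p))%:E)%E.
Proof.
move=> N0 mh ih cF F0.
have iG := integrable_moving mh ih (continuous_comp_shear cF) (supported_shear N0 F0).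
have mH : measurable_fun [set: plane] (fun p : plane => (h (p.2 - x0 - s * p.1) * F p)%:E).
  apply/measurable_EFinP; apply: measurable_funM; last exact: continuous_measurable_plane.
  apply: measurableT_comp mh _.
  apply: measurable_funB; first by apply: measurable_funB => //; exact: measurable_snd.
  by apply: measurable_funM => //; exact: measurable_fst.
have E : (fun p : plane => (h (p.2 - x0 - s * p.1) * F p)%:E) \o shear x0 s =
         (fun p : plane => (h p.2 * F (shear x0 s p))%:E).
  by apply/funext => -[t y]; rewrite /= (_ : y + x0 + s * t - x0 - s * t = y)//; ring.
split; first by apply: (integrable_shear (a := x0) (s := s) mH); rewrite E.
rewrite (integral_shear (a := x0) (s := s) mH) ?E//.
by apply: eq_integral => p _; exact: (congr1 (@^~ p) E).
Qed.

Variable Phi : R * R -> R.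
Hypothesis tPhi : test_function Phi.

Lemma is_derive_slice (t y : R) :
  is_derive y 1 (fun y => Phi (t, y + x0 + s * t)) (d_x Phi (t, y + x0 + s * t)).
Proof.
have daff : is_derive y 1 (fun y => y + x0 + s * t) 1.
  have d := is_deriveD (is_deriveD (is_derive_id y 1) (is_derive_cst x0 y 1)) (is_derive_cst (s * t) y 1).
  by apply: (is_derive_congr d); rewrite !addr0.
have d := @is_derive1_comp _ (fun z => Phi (t, z)) (fun y => y + x0 + s * t) y _ _
  ((is_derive_xE Phi (t, y + x0 + s * t) _).1 (test_function_is_derive (t, y + x0 + s * t) tPhi).2) daff.
by apply: (is_derive_congr d); rewrite mulr1.
Qed.

Lemma C1_compact_slice (N t : R) : 0 <= N -> supported_in_square N Phi ->
  supported_in_square N (d_x Phi) ->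
  C1_compact (moving_radius N) (fun y => Phi (t, y + x0 + s * t))
    (fun y => d_x Phi (t, y + x0 + s * t)).
Proof.
move=> N0 P0 Px0; have [_ _ cPx] := test_function_continuous tPhi; split.
- by move=> y; exact: is_derive_slice.
- have cline : continuous (fun y : R => (t, y) : R * R).
    by move=> y; apply: (cvg_pair (G := nbhs t) (H := nbhs y)); [exact: cvg_cst|exact: cvg_id].
  by move=> y; have := continuous_comp (cline y) (@continuous_comp_shear _ cPx (t, y)).
- move=> y yN; split.
    exact: (supported_shear N0 P0 (p := (t, y)) (or_intror yN)).
  exact: (supported_shear N0 Px0 (p := (t, y)) (or_intror yN)).
Qed.

(** The transport derivative, along the lines [x = y + x0 + s t]. *)
Definition d_moving (p : R * R) : R := d_t Phi p + s * d_x Phi p.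

(** The density of the law is stationary in the moving frame: on the line
    through [y] it is a constant [e], and what it is tested against is the
    derivative of [Phi] along that line. *)
Lemma integral_d_moving (e N y : R) : 0 <= N -> supported_in_square N Phi ->
  supported_in_square N (d_t Phi) -> supported_in_square N (d_x Phi) ->
  (\int[mu]_t (e * d_moving (t, y + x0 + s * t))%:E = 0)%E.
Proof.
move=> N0 P0 Pt0 Px0; have [cP cPt cPx] := test_function_continuous tPhi.
have d0 t : N <= `|t| -> d_moving (t, y + x0 + s * t) = 0.
  by move=> tN; rewrite /d_moving Pt0 ?Px0 ?mulr0 ?addr0//; left.
have cd : continuous (fun t => e * d_moving (t, y + x0 + s * t)).
  have cline : continuous (fun t : R => (t, y) : R * R).
    by move=> t; apply: (cvg_pair (G := nbhs t) (H := nbhs y)); [exact: cvg_id|exact: cvg_cst].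
  move=> t; apply: cvgM; first exact: cvg_cst.
  apply: cvgD; first by have := continuous_comp (cline t) (@continuous_comp_shear _ cPt (t, y)).
  apply: cvgM; first exact: cvg_cst.
  by have := continuous_comp (cline t) (@continuous_comp_shear _ cPx (t, y)).
have dline t := is_derive_along_line s (y + x0) t tPhi.
have cline : continuous (fun t : R => e * Phi (t, y + x0 + s * t)).
  move=> t; apply: cvgM; first exact: cvg_cst.
  by have [h _] := dline t; apply/differentiable_continuous/derivable1_diffP.
rewrite (FTC_compact (S := [::]) (F := fun t => e * Phi (t, y + x0 + s * t)) N0) //.
- by rewrite !P0 ?subrr//=; left; rewrite ?normrN ler_norm.
- move=> t _; split; last exact: cd.
  by have := is_deriveZ e (dline t).
- exact: continuous_measurable_fun.
- apply: continuous_compact_integrable; first exact: segment_compact.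
  exact: continuous_subspaceT.
- by move=> t tN; rewrite d0 ?mulr0// ltW.
Qed.

Lemma measurable_moving (h : R -> R) : measurable_fun [set: measurableTypeR R] h ->
  measurable_fun [set: plane] (fun p : plane => h (p.2 - x0 - s * p.1)).
Proof.
move=> mh; apply: measurableT_comp mh _.
apply: measurable_funB; first by apply: measurable_funB => //; exact: measurable_snd.
by apply: measurable_funM => //; exact: measurable_fst.
Qed.

(** Multiply by a continuous function with compact support that is [1] on the
    given compact set, to which [integral_moving] applies. *)
Lemma locally_integrable_moving (h : R -> R) :
  measurable_fun [set: measurableTypeR R] h -> loc_integrable h ->
  locally_integrable_plane (fun p => h (p.2 - x0 - s * p.1)).
Proof.
move=> mh ih K cK; have mK := compact_measurable_plane cK.
have [C [_ hC]] : bounded_set K by exact: compact_bounded.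
pose N := `|C| + 1; have CN : C < N by rewrite (le_lt_trans (ler_norm C))// ltrDl.
have N0 : 0 <= N by rewrite addr_ge0.
pose cut (r : R) : R := Num.max 0 (Num.min 1 (N + 1 - `|r|)).
have ccut : continuous cut.
  move=> r; apply: (@continuous_max _ _ (cst 0) (fun r : R => Num.min 1 (N + 1 - `|r|))); first exact: cvg_cst.
  apply: (@continuous_min _ _ (cst 1) (fun r : R => N + 1 - `|r|)); first exact: cvg_cst.
  by apply: cvgB; [exact: cvg_cst|exact: norm_continuous].
have cut1 r : `|r| <= N -> cut r = 1.
  by move=> rN; rewrite /cut min_l ?max_r//; lra.
have cut0 r : N + 1 <= `|r| -> cut r = 0.
  by move=> rN; rewrite /cut max_l// ge_min; apply/orP; right; lra.
have cT : continuous (tensor cut cut).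
  move=> p; apply: cvgM.
  + by apply: (cvg_comp fst cut); [exact: cvg_fst|exact: ccut].
  + by apply: (cvg_comp snd cut); [exact: cvg_snd|exact: ccut].
have sT : supported_in_square (N + 1) (tensor cut cut).
  by move=> p [] h0; rewrite /tensor (cut0 _ h0) ?mul0r ?mulr0.
have [iT _] := @integral_moving h _ (N + 1) (addr_ge0 N0 ler01) mh ih cT sT.
have iK := integrableS measurableT mK (@subsetT _ _) iT.
apply: (le_integrable mK _ _ iK).
  by apply/measurable_EFinP; apply: measurable_funS (measurable_moving mh).
move=> p Kp; rewrite lee_fin /tensor.
have /= := hC N CN p Kp; rewrite prod_normE ge_max => /andP[h1 h2].
by rewrite (cut1 _ h1) (cut1 _ h2) !mulr1.
Qed.

End moving_frame.

(** * The conservation law along a travelling wave *)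

Section travelling_wave.
Context {R : realType}.
Variables (M s m : R) (phi : R -> R).
Hypothesis Hphi : decaying_cuspon_profile M s m phi.
Variable l : R.
Hypothesis l0 : 0 <= l.
Hypothesis Hl : 0 < l -> - (M * m) - (M + m) * (s - M - m) = s ^+ 2.
Variable x0 : R.
Notation mu := (@lebesgue_measure R).
Notation plane := (measurableTypeR R * measurableTypeR R)%type.

Let psi := wave_profile s phi l.
Let psi' := wave_slope phi l.

Definition wave (p : R * R) : R := psi (p.2 - x0 - s * p.1).
Definition wave_dx (p : R * R) : R := psi' (p.2 - x0 - s * p.1).

Let mp : measurable_fun [set: measurableTypeR R] psi := measurable_wave_profile Hphi l.
Let ms : measurable_fun [set: measurableTypeR R] psi' := measurable_wave_slope Hphi l0.
Let ip : loc_integrable psi := loc_integrable_wave_profile Hphi l.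
Let is' : loc_integrable psi' := loc_integrable_wave_slope Hphi l0 Hl.

Lemma wave_is_weak_dx : is_weak_dx wave wave_dx.
Proof.
split.
- by split; [exact: measurable_moving|exact: locally_integrable_moving].
- by split; [exact: measurable_moving|exact: locally_integrable_moving].
- move=> Phi tPhi; have [cP cPt cPx] := test_function_continuous tPhi.
  have [N N0 [P0 Pt0 Px0]] := test_function_support tPhi.
  have [i1 E1] := integral_moving x0 s N0 mp ip cPx Px0.
  have [i2 E2] := integral_moving x0 s N0 ms is' cP P0.
  have j1 := integrable_moving mp ip (continuous_comp_shear (x0 := x0) (s := s) cPx) (@supported_shear _ x0 s N _ N0 Px0).
  have j2 := integrable_moving ms is' (continuous_comp_shear (x0 := x0) (s := s) cP) (@supported_shear _ x0 s N _ N0 P0).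
  apply: (etrans E1); apply: (etrans _ (congr1 oppe (esym E2))); apply: (integralD_eq0 j1 j2).
  have j12 : lebesgue_plane.-integrable setT (fun p : plane =>
      (psi p.2 * d_x Phi (shear x0 s p) + psi' p.2 * Phi (shear x0 s p))%:E).
    by have := integrableD measurableT j1 j2.
  rewrite /lebesgue_plane -(integral12_prod_meas1 j12) /fubini_F.
  apply: integral0_eq => t _.
  apply: (wave_by_parts Hphi l0 Hl (N := moving_radius x0 s N)).
    exact: le_trans (@moving_radius_ge _ x0 s N N0).
  exact: C1_compact_slice.
Qed.

(** Translating the variable of integration reduces to the convolution computed
    in the moving frame. *)
Lemma nonlocal_P_wave p :
  nonlocal_P wave wave_dx p = wave_pressure M s m phi l (p.2 - x0 - s * p.1).
Proof.
rewrite /nonlocal_P /Rintegral.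
have -> : (fun z => (1 / 2 * expR (- `|p.2 - z|) *
     (wave (p.1, z) ^+ 2 + 1 / 2 * wave_dx (p.1, z) ^+ 2))%:E) =
   (fun z => (1 / 2 * expR (- `|p.2 - z|) * wave_source s phi l (z - x0 - s * p.1))%:E) by [].
rewrite (ge0_integral_translation (x0 + s * p.1)); last 2 first.
- apply: measurable_funM.
    apply: measurable_funM => //; apply: continuous_measurable_fun => z.
    apply: (cvg_comp (fun z : R => - `|p.2 - z|) expR); last exact: continuous_expR.
    by apply: cvgN; apply: cvg_norm; apply: cvgB; [exact: cvg_cst|exact: cvg_id].
  apply: measurableT_comp (measurable_wave_source Hphi l0) _.
  by apply: measurable_funB => //; exact: measurable_funB.
- by move=> z; rewrite !mulr_ge0 ?expR_ge0 ?wave_source_ge0.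
pose y := p.2 - x0 - s * p.1.
have E z : 1 / 2 * expR (- `|p.2 - (x0 + s * p.1 + z)|) *
     wave_source s phi l (x0 + s * p.1 + z - x0 - s * p.1) =
   1 / 2 * expR (- `|y - z|) * wave_source s phi l z.
  have -> : p.2 - (x0 + s * p.1 + z) = y - z by rewrite /y; ring.
  by have -> : x0 + s * p.1 + z - x0 - s * p.1 = z by ring.
under eq_integral do rewrite E.
by rewrite (integral_wave_source Hphi l0 Hl y).
Qed.

Definition law_integrand (u ux P : R * R -> R) (Phi : R * R -> R) (p : R * R) : R :=
  (u p ^+ 2 + ux p ^+ 2) * d_t Phi p +
  (u p * (u p ^+ 2 + ux p ^+ 2) - u p ^+ 3 + 2 * P p * u p) * d_x Phi p.

(** After the change of variables, the density is paired with a transport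
    derivative, which contributes nothing, and the flux with a space derivative,
    which sees only its jumps at the two corners. *)
Lemma law_functional Phi : test_function Phi ->
  (\int[lebesgue_plane]_p (law_integrand wave wave_dx (nonlocal_P wave wave_dx) Phi p)%:E =
   \int[mu]_t ((s ^+ 3 + M * m ^+ 2) *
      (Phi (t, l + x0 + s * t) - Phi (t, - l + x0 + s * t)))%:E)%E.
Proof.
move=> tPhi; have [cP cPt cPx] := test_function_continuous tPhi.
have [N N0 [P0 Pt0 Px0]] := test_function_support tPhi.
pose En := wave_energy s phi l; pose Fl := wave_flux M s m phi l.
have mE : measurable_fun [set: measurableTypeR R] En := measurable_wave_energy Hphi l0.
have mF : measurable_fun [set: measurableTypeR R] Fl := measurable_wave_flux Hphi l0.
have iE : loc_integrable En := loc_integrable_wave_energy Hphi l0 Hl.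
have iF : loc_integrable Fl := loc_integrable_wave_flux Hphi l0.
have cD : continuous (d_moving s Phi).
  move=> p; apply: cvgD; first exact: cPt.
  by apply: cvgM; [exact: cvg_cst|exact: cPx].
have D0 : supported_in_square N (d_moving s Phi).
  by move=> p hp; rewrite /d_moving (Pt0 _ hp) (Px0 _ hp) mulr0 addr0.
have [i1 E1] := integral_moving x0 s N0 mE iE cD D0.
have [i2 E2] := integral_moving x0 s N0 mF iF cPx Px0.
have j1 := integrable_moving mE iE (continuous_comp_shear (x0 := x0) (s := s) cD) (@supported_shear _ x0 s N _ N0 D0).
have j2 := integrable_moving mF iF (continuous_comp_shear (x0 := x0) (s := s) cPx) (@supported_shear _ x0 s N _ N0 Px0).
transitivity (\int[lebesgue_plane]_p ((En (p.2 - x0 - s * p.1) * d_moving s Phi p)%:E +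
    (Fl (p.2 - x0 - s * p.1) * d_x Phi p)%:E))%E.
  apply: eq_integral => p _; rewrite -EFinD; congr (_%:E).
  rewrite /law_integrand nonlocal_P_wave /wave /wave_dx -/psi -/psi' /En /Fl /wave_flux /wave_energy
    /d_moving -/psi -/psi'.
  ring.
rewrite (integralD measurableT i1 i2) E1 E2.
have -> : (\int[lebesgue_plane]_p (En p.2 * d_moving s Phi (shear x0 s p))%:E = 0)%E.
  rewrite /lebesgue_plane -(integral21_prod_meas1 j1) /fubini_G.
  apply: integral0_eq => y _.
  exact: (integral_d_moving x0 s tPhi (En y) y N0 P0 Pt0 Px0).
rewrite add0e /lebesgue_plane -(integral12_prod_meas1 j2) /fubini_F.
apply: eq_integral => t _.
have NN0 : 0 <= moving_radius x0 s N by exact: le_trans (@moving_radius_ge _ x0 s N N0).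
have := wave_flux_pairing Hphi l0 Hl NN0 (@C1_compact_slice _ x0 s Phi tPhi N t N0 P0 Px0).
by rewrite opprK => <-.
Qed.

End travelling_wave.

(** * Independence of the choice of weak derivative *)

Section weak_derivative_choice.
Context {R : realType}.
Notation mu := (@lebesgue_measure R).
Notation plane := (measurableTypeR R * measurableTypeR R)%type.

Lemma integrable_mul_test (f : plane -> R) (Phi : R * R -> R) :
  measurable_fun [set: plane] f -> locally_integrable_plane f -> test_function Phi ->
  lebesgue_plane.-integrable setT (fun p => (f p * Phi p)%:E).
Proof.
move=> mf lf tPhi; have [cP _ _] := test_function_continuous tPhi.
have cK := tPhi.2; set K := closure _ in cK.
have out p : ~ K p -> Phi p = 0.
  by move=> Kp; apply/eqP/negPn/negP => h; apply: Kp; exact: subset_closure.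
have [C C0 hC] := bounded_compact_support cK cP out.
have mK : measurable (K : set plane) := compact_measurable_plane cK.
have iK := integrableZl measurableT C ((integrable_mkcond _ mK).1 (lf K cK)).
apply: (le_integrable measurableT _ _ iK).
  by apply/measurable_EFinP; apply: measurable_funM => //; exact: continuous_measurable_plane.
move=> p _; rewrite patchE; case: ifPn => [_|/negP h].
  by rewrite /= lee_fin !normrM mulrC ler_wpM2r// (ger0_norm C0).
by rewrite out ?mulr0 ?abse0// => Kp; apply: h; rewrite inE.
Qed.

(** The difference of two weak derivatives is orthogonal to all test
    functions. *)
Lemma weak_dx_ae_unique (u v w : R * R -> R) : is_weak_dx u v -> is_weak_dx u w ->
  {ae lebesgue_plane, forall p : plane, v p = w p}.
Proof.
move=> [_ [mv lv] uv] [_ [mw lw] uw].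
have : {ae lebesgue_plane, forall p : plane, v p - w p = 0}.
  apply: ae0_of_test_functions.
  - exact: measurable_funB.
  - by move=> K cK; exact: (integrableB (compact_measurable_plane cK) (lv K cK) (lw K cK)).
  - move=> Phi tPhi.
    have iv := integrable_mul_test mv lv tPhi; have iw := integrable_mul_test mw lw tPhi.
    under eq_integral do rewrite mulrBl EFinB.
    rewrite (integralB measurableT iv iw).
    have -> : (\int[lebesgue_plane]_p (v p * Phi p)%:E = \int[lebesgue_plane]_p (w p * Phi p)%:E)%E.
      by apply: oppe_inj; rewrite -uv// -uw.
    by rewrite subee// integrable_fin_num.
by apply: filterS => p /eqP; rewrite subr_eq0 => /eqP.
Qed.

(** The integrand is nonnegative and jointly measurable in the point and the
    variable of integration, so Tonelli's theorem applies. *)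
Lemma measurable_nonlocal_P (u ux : R * R -> R) :
  measurable_fun [set: plane] u -> measurable_fun [set: plane] ux ->
  measurable_fun [set: plane] (nonlocal_P u ux).
Proof.
move=> mu' mux.
pose f (q : plane * measurableTypeR R) : \bar R :=
  (1 / 2 * expR (- `|q.1.2 - q.2|) *
     (u (q.1.1, q.2) ^+ 2 + 1 / 2 * ux (q.1.1, q.2) ^+ 2))%:E.
have mslice : measurable_fun [set: plane * measurableTypeR R]
    (fun q : plane * measurableTypeR R => (q.1.1, q.2) : plane).
  apply: measurable_fun_pair; last exact: measurable_snd.
  exact: measurableT_comp measurable_fst measurable_fst.
have mf : measurable_fun [set: plane * measurableTypeR R] f.
  apply/measurable_EFinP; apply: measurable_funM.
    apply: measurable_funM => //.
    apply: measurableT_comp; first exact: measurable_expR.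
    apply: measurableT_comp => //; apply: measurableT_comp => //.
    apply: measurable_funB; last exact: measurable_snd.
    exact: measurableT_comp measurable_snd measurable_fst.
  apply: measurable_funD.
    by apply: measurable_funX; exact: measurableT_comp mu' mslice.
  by apply: measurable_funM => //; apply: measurable_funX; exact: measurableT_comp mux mslice.
have f0 q : (0 <= f q)%E.
  rewrite lee_fin; apply: mulr_ge0; first by apply: mulr_ge0 => //; exact: expR_ge0.
  by rewrite addr_ge0 ?sqr_ge0// mulr_ge0 ?sqr_ge0.
have mF := measurable_fun_fubini_tonelli_F (m2 := mu) f mf f0.
by apply: (measurableT_comp _ mF); exact: fine_measurable.
Qed.

(** The measure of a null set of the plane is the integral of the measures of
    its sections, which must then vanish for almost every time. *)
Lemma ae_plane_section (Q : plane -> Prop) : {ae lebesgue_plane, forall p, Q p} ->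
  {ae mu, forall t, {ae mu, forall x, Q (t, x)}}.
Proof.
move=> [A [mA A0 QA]].
have mphi : measurable_fun [set: measurableTypeR R] (mu \o xsection A).
  exact: measurable_fun_xsection.
have : (\int[mu]_t `|(mu \o xsection A) t| = 0)%E.
  rewrite -[RHS]A0 /lebesgue_plane /= /product_measure1; apply: eq_integral => t _.
  by rewrite gee0_abs.
move/(ae_eq_integral_abs mu measurableT mphi).1.
apply: filterS => t /(_ I) /= h.
exists (xsection A t); split => //; first exact: measurable_xsection.
by move=> x /= nQ; rewrite /xsection/= inE; exact: (QA (t, x) nQ).
Qed.

(** At a time when the sections of [v] and [w] agree almost everywhere, the two
    convolutions agree at every point. *)
Lemma nonlocal_P_ae_eq (u v w : R * R -> R) : measurable_fun [set: plane] u ->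
  measurable_fun [set: plane] v -> measurable_fun [set: plane] w ->
  {ae lebesgue_plane, forall p : plane, v p = w p} ->
  {ae lebesgue_plane, forall p : plane, nonlocal_P u v p = nonlocal_P u w p}.
Proof.
move=> mu' mv mw /ae_plane_section [A [mA A0 hA]].
exists (A `*` setT); split.
- exact: measurableX.
- have -> : lebesgue_plane (A `*` setT) = (mu A * mu setT)%E by exact: product_measure1E.
  by rewrite A0 mul0e.
move=> -[t x] /= h; split => //; apply: hA => /= tvw; apply: h.
have mterm (g : R * R -> R) : measurable_fun [set: plane] g ->
    measurable_fun [set: measurableTypeR R] (fun z => (1 / 2 * expR (- `|x - z|) *
      (u (t, z) ^+ 2 + 1 / 2 * g (t, z) ^+ 2))%:E).
  move=> mg; apply/measurable_EFinP; apply: measurable_funM.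
    apply: measurable_funM => //.
    apply: measurableT_comp; first exact: measurable_expR.
    apply: measurableT_comp => //; apply: measurableT_comp => //.
    exact: measurable_funB.
  apply: measurable_funD.
    by apply: measurable_funX; exact: measurableT_comp mu' (measurable_pair1 t).
  by apply: measurable_funM => //; apply: measurable_funX; exact: measurableT_comp mg (measurable_pair1 t).
rewrite /nonlocal_P /Rintegral; congr (fine _); apply: ae_eq_integral => //=.
- exact: mterm mv.
- exact: mterm mw.
- by apply: filterS tvw => z /= ->.
Qed.

End weak_derivative_choice.

(** * Cuspons and stumpons *)

Section cuspons_and_stumpons.
Context {R : realType}.
Notation mu := (@lebesgue_measure R).
Notation plane := (measurableTypeR R * measurableTypeR R)%type.

Lemma cuspon_is_wave (M s m x0 : R) (phi : R -> R) (u : R * R -> R) :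
  decaying_cuspon_profile M s m phi ->
  (forall t x, u (t, x) = phi (x - x0 - s * t)) -> u = wave s phi 0 x0.
Proof.
move=> Hphi uE; apply/funext => -[t x].
rewrite uE /wave (wave_profileE Hphi) subr0 (max_l (normr_ge0 _)) /=.
have [y0|y0] := leP 0 (x - x0 - s * t); first by rewrite ger0_norm.
by rewrite ltr0_norm// (cuspon_even Hphi).
Qed.

Lemma measurable_law_integrand (u ux P Phi : R * R -> R) :
  measurable_fun [set: plane] u -> measurable_fun [set: plane] ux ->
  measurable_fun [set: plane] P -> test_function Phi ->
  measurable_fun [set: plane] (law_integrand u ux P Phi).
Proof.
move=> mu' mux mP tPhi; have [cP cPt cPx] := test_function_continuous tPhi.
have mE : measurable_fun [set: plane] (fun p : plane => u p ^+ 2 + ux p ^+ 2).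
  by apply: measurable_funD; exact: measurable_funX.
apply: measurable_funD; first by apply: measurable_funM => //; exact: continuous_measurable_plane.
apply: measurable_funM; last exact: continuous_measurable_plane.
apply: measurable_funD.
  by apply: measurable_funB; [exact: measurable_funM|exact: measurable_funX].
by apply: measurable_funM => //; exact: measurable_funM.
Qed.

Lemma law_integral_independent (u v w Phi : R * R -> R) :
  is_weak_dx u v -> is_weak_dx u w -> test_function Phi ->
  (\int[lebesgue_plane]_p (law_integrand u v (nonlocal_P u v) Phi p)%:E =
   \int[lebesgue_plane]_p (law_integrand u w (nonlocal_P u w) Phi p)%:E)%E.
Proof.
move=> uv uw tPhi; have vw := weak_dx_ae_unique uv uw.
have [[mu' _] [mv _] _] := uv; have [_ [mw _] _] := uw.
have PQ := nonlocal_P_ae_eq mu' mv mw vw.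
apply: ae_eq_integral => //.
- by apply/measurable_EFinP; apply: measurable_law_integrand => //; exact: measurable_nonlocal_P.
- by apply/measurable_EFinP; apply: measurable_law_integrand => //; exact: measurable_nonlocal_P.
- by apply: filterS2 vw PQ => p E1 E2 _; rewrite /law_integrand/= E1 E2.
Qed.

(** Eliminating [M = s - 2 m] from the stumpon relation leaves
    [(s - m) (s + 3 m) = 0], and [s] differs from [m]. *)
Lemma stumpon_jump_neq0 (M s m : R) : 2 * m = s - M -> m < s < M \/ M < s < m ->
  - (M * m) - (M + m) * (s - M - m) = s ^+ 2 -> s ^+ 3 + M * m ^+ 2 != 0.
Proof.
move=> Em ord E.
have EM : M = s - 2 * m by lra.
have sm : s - m != 0.
  by rewrite subr_eq0; case: ord => /andP[h1 h2]; [rewrite gt_eqF|rewrite lt_eqF].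
have Es : s = - 3 * m.
  apply/eqP; rewrite -subr_eq0; apply/eqP; apply: (mulfI sm); rewrite mulr0.
  by move: E; rewrite EM !expr2; lra.
have m0 : m != 0 by apply: contraNneq sm => m0; rewrite Es m0 mulr0 subr0.
rewrite (_ : _ + _ = - 32 * m ^+ 3); first by rewrite mulf_neq0 ?expf_neq0// lt_eqF//; lra.
by rewrite EM Es; ring.
Qed.

Lemma integral_gt0 (f : R -> R) (a b : R) : a < b ->
  measurable_fun [set: measurableTypeR R] f -> (forall x, 0 <= f x) ->
  (forall x, a < x < b -> 0 < f x) -> (\int[mu]_x (f x)%:E != 0)%E.
Proof.
move=> ab mf f0 fab; apply/eqP => I0.
have : (\int[mu]_x `|(f x)%:E| = 0)%E.
  by rewrite -[RHS]I0; apply: eq_integral => x _; rewrite gee0_abs// lee_fin.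
have mf' : measurable_fun [set: measurableTypeR R] (fun x => (f x)%:E) by exact/measurable_EFinP.
move/(ae_eq_integral_abs mu measurableT mf').1 => [A [mA A0 fA]].
have : (mu `]a, b[ <= mu A)%E.
  apply: le_measure; rewrite ?inE//.
  move=> x /=; rewrite in_itv/= => xab; apply: fA => /(_ I) /= [fx].
  by have := fab x xab; rewrite fx ltxx.
by rewrite A0 lebesgue_measure_itv/= lte_fin ab -EFinB lee_fin subr_le0 leNgt ab.
Qed.

(** The test function is a product of bumps, in time around [0] and in space
    over [`]x0, x0 + 2 l[]. During that short time the right corner stays in the
    support of the second bump, and the left corner stays to its left. *)
Lemma stumpon_not_conservative (u : R * R -> R) :
  stumpon_with_decay u -> ~ satisfies_conservation_law_weakly u.
Proof.
move=> [M [s [m [l [x0 [phi [Hphi Hs lpos uE]]]]]]] [ux uux law].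
have l0 := ltW lpos.
have uW : u = wave s phi l x0 by apply/funext => -[t x]; rewrite uE.
have wdx := wave_is_weak_dx Hphi l0 (fun=> Hs) x0; rewrite -uW in wdx.
(* For [|t| < tau] the corners move by less than [l]. *)
pose tau := l / (1 + `|s|).
have tau0 : 0 < tau by rewrite divr_gt0// ltr_pwDl.
pose al := bump 1 (- tau) tau; pose be := bump 1 x0 (x0 + 2 * l).
have tT : test_function (tensor al be).
  apply: (test_function_tensor (a := - tau) (b := tau) (c := x0) (d := x0 + 2 * l)).
  - exact: smooth1_bump.
  - exact: smooth1_bump.
  - by move=> t; exact: bump_eq0.
  - by move=> x; exact: bump_eq0.
pose w t := al t * be (l + x0 + s * t).
have K0 := stumpon_jump_neq0 (cuspon_param Hphi) (cuspon_order Hphi) Hs.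
have st t : - tau < t < tau -> `|s * t| < l.
  rewrite -ltr_norml => h; rewrite normrM.
  have h1 : `|t| * (1 + `|s|) < l by rewrite -ltr_pdivlMr// ltr_pwDl.
  by have := normr_ge0 t; lra.
have be0 t : - tau < t < tau -> be (- l + x0 + s * t) = 0.
  move=> /st; rewrite ltr_norml => /andP[h1 h2]; apply: bump_eq0 => //.
  by rewrite negb_and -!leNgt; apply/orP; left; lra.
have I0 : (\int[mu]_t ((s ^+ 3 + M * m ^+ 2) * w t)%:E = 0)%E.
  have E0 := law _ tT; have E1 := law_integral_independent uux wdx tT.
  have E2 := law_functional Hphi l0 (fun=> Hs) x0 tT; rewrite -uW -E1 in E2.
  rewrite -[RHS]E0 [RHS]E2; apply: eq_integral => t _; congr ((_ * _)%:E); rewrite /w /tensor/= -mulrBr.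
  have [/be0 ->|h] := boolP (- tau < t < tau); first by rewrite subr0.
  have -> : al t = 0 by exact: bump_eq0.
  by rewrite !mul0r.
have w0 t : 0 <= w t.
  by rewrite mulr_ge0//; [case/andP: (bump_ge0_le1 1 (- tau) tau t)|
    case/andP: (bump_ge0_le1 1 x0 (x0 + 2 * l) (l + x0 + s * t))].
have mw : measurable_fun [set: measurableTypeR R] w.
  have cal : continuous al := @smooth1_continuous _ _ 0%N (@smooth1_bump _ _ _ _).
  have cbe : continuous be := @smooth1_continuous _ _ 0%N (@smooth1_bump _ _ _ _).
  apply: measurable_funM; first exact: continuous_measurable_fun.
  apply: (measurableT_comp (continuous_measurable_fun cbe)).
  by apply: measurable_funD => //; exact: measurable_funM.
suff : (\int[mu]_t (`|s ^+ 3 + M * m ^+ 2| * w t)%:E != 0)%E.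
  apply/negP; rewrite negbK; apply/eqP.
  have [Kpos|Kneg] := leP 0 (s ^+ 3 + M * m ^+ 2); first by rewrite ger0_norm.
  have E : (\int[mu]_t ((s ^+ 3 + M * m ^+ 2) * w t)%:E =
      - \int[mu]_t (`|s ^+ 3 + M * m ^+ 2| * w t)%:E)%E.
    rewrite -integral_ge0N; last by move=> t _; rewrite lee_fin mulr_ge0.
    by apply: eq_integral => t _; rewrite -EFinN (ltr0_norm Kneg) mulNr opprK.
  by move: I0; rewrite E => /eqP; rewrite oppe_eq0 => /eqP.
apply: (integral_gt0 (a := - tau) (b := tau)).
- by rewrite gtrN.
- exact: measurable_funM.
- by move=> t; rewrite mulr_ge0.
- move=> t ht; rewrite mulr_gt0 ?normr_gt0// mulr_gt0 ?bump_gt0//.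
  by have := st t ht; rewrite ltr_norml => /andP[h1 h2]; apply/andP; split; lra.
Qed.

(** The two corners coincide for [l = 0], so their contributions cancel. *)
Lemma cuspon_conservative (u : R * R -> R) :
  cuspon_with_decay u -> satisfies_conservation_law_weakly u.
Proof.
move=> [M [s [m [x0 [phi [Hphi uE]]]]]].
rewrite (cuspon_is_wave Hphi uE).
have Hl : 0 < (0 : R) -> - (M * m) - (M + m) * (s - M - m) = s ^+ 2 by rewrite ltxx.
exists (wave_dx s phi 0 x0); first exact: (wave_is_weak_dx Hphi (lexx 0) Hl).
move=> /= Phi tPhi; rewrite [LHS](law_functional Hphi (lexx 0) Hl x0 tPhi).
by apply: integral0_eq => t _; rewrite oppr0 subrr mulr0.
Qed.

End cuspons_and_stumpons.

Theorem theorem4p1 (R : realType) (u : R * R -> R) :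
  (stumpon_with_decay u -> ~ satisfies_conservation_law_weakly u) /\
  (cuspon_with_decay u -> satisfies_conservation_law_weakly u).
Proof. by split; [exact: stumpon_not_conservative|exact: cuspon_conservative]. Qed.
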